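(* (a) Let $F:\mathbf{Comp}\to\mathbf{Comp}$ be a 1-mec functor. Then $F$ is skeletal if and only if for each zero-dimensional compact Hausdorff space $Z$ the map $F\mathit{2}_Z:F(Z\oplus 2)\to F(Z\oplus 1)$ is skeletal. (b) Let $F:\mathbf{Comp}\to\mathbf{Comp}$ be a 1-mecw functor. Then $F$ is skeletal if and only if for each zero-dimensional compact metrizable space $Z$ the map $F\mathit{2}_Z:F(Z\oplus 2)\to F(Z\oplus 1)$ is skeletal.
   Context: All spaces are Hausdorff and all maps are continuous. $\mathbf{Comp}$ is the category of compact Hausdorff spaces (compacta) and continuous maps. A map $f:X\to Y$ between topological spaces is skeletal if for each nowhere dense subset $A\subset Y$ the preimage $f^{-1}(A)$ is nowhere dense in $X$. A functor $F:\mathbf{Comp}\to\mathbf{Comp}$ is: monomorphic (resp. epimorphic) if $Ff$ is injective (resp. surjective) for every injective (resp. surjective) map $f$ between compacta; continuous if it preserves limits of inverse spectra of compacta, i.e. for each inverse spectrum $\mathcal S$ of compacta over a directed set the natural map $F(\lim\mathcal S)\to\lim F\mathcal S$ is a homeomorphism; skeletal if for any open surjection $f:X\to Y$ between compacta the map $Ff:FX\to FY$ is skeletal; weight-preserving if $w(FX)\le w(X)$ for each infinite compactum $X$, where $w$ denotes the weight (smallest cardinality of a base). A commutative square of continuous maps between compacta, with maps $\tilde f:\tilde X\to\tilde Y$, $p_X:\tilde X\to X$, $p_Y:\tilde Y\to Y$, $f:X\to Y$ and $p_Y\circ\tilde f=f\circ p_X$, is bicommutative if $\tilde f(p_X^{-1}(x))=p_Y^{-1}(f(x))$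 for all $x\in X$. $F$ preserves finite 1-preimages if it preserves the bicommutativity of such squares in which $f,\tilde f$ are injective, $p_X$ is bijective and $X$ is finite. (For monomorphic $F$ this means: for any map $f:X\to Y$ between compacta and finite $Z\subset Y$ such that $f^{-1}(z)$ is a singleton for every $z\in Z$, $(Ff)^{-1}(FZ)=F(f^{-1}(Z))$, where for closed $A\subset X$ the space $FA$ is identified with its image in $FX$ under $F$ of the inclusion.) A 1-mec functor is a monomorphic, epimorphic, continuous functor that preserves finite 1-preimages. A 1-mecw functor is a weight-preserving 1-mec functor. For a natural number $n$, $Z\oplus n$ is the topological sum of $Z$ and the discrete space $n=\{0,\dots,n-1\}$. The map $\mathit{2}_Z:Z\oplus 2\to Z\oplus 1$ is the identity on $Z$ and sends both points of the summand $2$ to the point $0$ of the summand $1$. *)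

(* Defs.v *)
From HB Require Import structures.
From mathcomp Require Import all_boot all_order all_algebra.
From mathcomp Require Import all_classical all_reals topology.

Set Implicit Arguments.
Unset Strict Implicit.
Unset Printing Implicit Defensive.

Import Order.TTheory GRing.Theory Num.Theory.

Local Open Scope classical_set_scope.
Local Open Scope ring_scope.

Section Topology.
Context {X Y : topologicalType}.

Definition open_map (f : X -> Y) : Prop :=
  forall U : set X, open U -> open (f @` U).

Definition homeomorphism (f : X -> Y) : Prop :=
  continuous f /\
  exists g : Y -> X, [/\ continuous g, cancel f g & cancel g f].

Definition nowhere_dense (A : set X) : Prop := interior (closure A) = set0.

(* The weight is a minimum of cardinals, so w(X) <= w(Y) says that every base
   of Y has at least the cardinality of some base of X. *)
Definition weight_le : Prop :=
  forall B : set (set Y), basis B ->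
  exists2 A : set (set X), basis A & (A #<= B)%card.

End Topology.
Arguments weight_le : clear implicits.

Definition skeletal {X Y : topologicalType} (f : X -> Y) : Prop :=
  forall A : set Y, nowhere_dense A -> nowhere_dense (f @^-1` A).

(* The library's [zero_dimensional] only asks that distinct points be separated
   by a clopen set, which is weaker in general (equivalent on compacta). *)
Definition zero_dim (X : topologicalType) : Prop :=
  exists2 B : set (set X), basis B & B `<=` clopen.

Definition metrizable (R : realType) (X : topologicalType) : Prop :=
  exists d : X -> X -> R,
    [/\ forall x y, d x y = 0 <-> x = y,
        forall x y, d x y = d y x,
        forall x y z, d x z <= d x y + d y z &
        forall U : set X, open U <->
          forall x, U x -> exists2 e : R, 0 < e & [set y | d x y < e] `<=` U].

Record compactum := Compactum {
  compactum_space :> topologicalType;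
  compactum_compact : compact [set: compactum_space];
  compactum_hausdorff : hausdorff_space compactum_space }.

Record comp_functor := CompFunctor {
  fobj :> compactum -> compactum;
  fmor : forall X Y : compactum,
    continuousType X Y -> continuousType (fobj X) (fobj Y);
  fmor_id : forall (X : compactum) (x : fobj X),
    fmor (idfun : continuousType X X) x = x;
  fmor_comp : forall (X Y Z : compactum)
    (f : continuousType X Y) (g : continuousType Y Z) (x : fobj X),
    fmor (g \o f : continuousType X Z) x = fmor g (fmor f x) }.

Record inverse_spectrum := InverseSpectrum {
  spec_index : Type;
  spec_le : spec_index -> spec_index -> Prop;
  spec_inhabited : exists i : spec_index, True;
  spec_le_refl : forall i, spec_le i i;
  spec_le_trans : forall i j k, spec_le i j -> spec_le j k -> spec_le i k;
  spec_directed : forall i j, exists k, spec_le i k /\ spec_le j k;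
  spec_space : spec_index -> compactum;
  spec_bond : forall i j,
    spec_le i j -> continuousType (spec_space j) (spec_space i);
  spec_bond_id : forall i (ii : spec_le i i) (x : spec_space i),
    spec_bond ii x = x;
  spec_bond_comp : forall i j k
    (ij : spec_le i j) (jk : spec_le j k) (ik : spec_le i k)
    (x : spec_space k), spec_bond ij (spec_bond jk x) = spec_bond ik x }.
Arguments spec_space : clear implicits.

Lemma closed_set_eq (X Y : topologicalType) (f g : X -> Y) :
  hausdorff_space Y -> continuous f -> continuous g ->
  closed [set x | f x = g x].
Proof.
move=> hY cf cg p clp; apply: hY => U V Uf Vg.
have [x [/= fgx [Ux Vx]]] := clp _ (filterI (cf _ U Uf : nbhs p (f @^-1` U)) (cg _ V Vg)).
by exists (f x); split => //; rewrite fgx.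
Qed.

Lemma set_type_compact (X : topologicalType) (A : set X) :
  compact A -> compact [set: A].
Proof.
move=> cA F PF _.
have GA : (set_val @ F) A.
  by apply: (@filterS _ F _ setT); [move=> x _; exact: set_valP | exact: filterT].
have [p [Ap clp]] := cA (set_val @ F) (fmap_proper_filter _ _) GA.
exists (exist _ p (mem_set Ap)); split => // U V FU [_ [[W oW <-] Wp] WV].
have FsU : (set_val @ F) (set_val @` U).
  by apply: (@filterS _ F _ U) => // x Ux; exists x.
have [_ [[x Ux <-] Wx]] := clp _ _ FsU (open_nbhs_nbhs (conj oW Wp)).
by exists x; split => //; exact: WV.
Qed.

Lemma set_type_hausdorff (X : topologicalType) (A : set X) :
  hausdorff_space X -> hausdorff_space A.
Proof.
move=> hX p q clpq; apply: val_inj; apply: hX => U V Up Vq.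
have [x [Ux Vx]] := clpq _ _ (@initial_continuous A X set_val p U Up)
  (@initial_continuous A X set_val q V Vq).
by exists (set_val x).
Qed.

Section Limit.
Variable S : inverse_spectrum.

Definition spec_prod : topologicalType :=
  prod_topology (fun i => compactum_space (spec_space S i)).

Definition threads : set spec_prod :=
  [set x | forall i j (ij : spec_le i j), spec_bond ij (x j) = x i].

Lemma spec_proj_continuous i :
  continuous (fun x : spec_prod => (x i : spec_space S i)).
Proof. exact: (@proj_continuous {classic spec_index S} (spec_space S) i). Qed.

Lemma threads_closed : closed threads.
Proof.
move=> x clx i j ij; apply: (closed_set_eq
  (f := fun y : spec_prod => spec_bond ij (y j)) (g := fun y => y i)).
- exact: compactum_hausdorff.
- by move=> y; apply: continuous_comp;
    [exact: spec_proj_continuous|exact: cts_fun].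
- exact: spec_proj_continuous.
- by apply: closure_subset clx => y; exact.
Qed.

Lemma spec_lim_compact : compact [set: threads].
Proof.
apply: set_type_compact; apply: (subclosed_compact threads_closed _ (B := setT)) => //.
have := @tychonoff {classic spec_index S} (spec_space S) (fun=> setT)
  (fun i => @compactum_compact (spec_space S i)).
by congr compact; apply/seteqP; split.
Qed.

Lemma spec_lim_hausdorff : hausdorff_space threads.
Proof.
apply: set_type_hausdorff.
by apply: (@hausdorff_product {classic spec_index S} (spec_space S)) => i;
  exact: compactum_hausdorff.
Qed.

Definition spec_lim : compactum := Compactum spec_lim_compact spec_lim_hausdorff.

Definition spec_lim_proj_fun i (x : spec_lim) : spec_space S i := set_val x i.

Lemma spec_lim_proj_continuous i : continuous (@spec_lim_proj_fun i).
Proof.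
move=> x; apply: (@continuous_comp _ _ _ set_val (fun y : spec_prod => y i)).
  exact: initial_continuous.
exact: spec_proj_continuous.
Qed.

Definition spec_lim_proj i : continuousType spec_lim (spec_space S i) :=
  mkcts (@spec_lim_proj_continuous i).

Lemma spec_lim_projE i j (ij : spec_le i j) (x : spec_lim) :
  spec_bond ij (spec_lim_proj j x) = spec_lim_proj i x.
Proof. exact: set_valP x i j ij. Qed.

End Limit.

Section ImageSpectrum.
Variables (F : comp_functor) (S : inverse_spectrum).

Lemma fmor_bond_id i (ii : spec_le i i) (x : F (spec_space S i)) :
  fmor F (spec_bond ii) x = x.
Proof.
rewrite -[RHS]fmor_id; congr (fmor F _ x).
by apply/continuousEP => y; exact: spec_bond_id.
Qed.

Lemma fmor_bond_comp i j k (ij : spec_le i j) (jk : spec_le j k)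
    (ik : spec_le i k) (x : F (spec_space S k)) :
  fmor F (spec_bond ij) (fmor F (spec_bond jk) x) = fmor F (spec_bond ik) x.
Proof.
rewrite -fmor_comp; congr (fmor F _ x).
by apply/continuousEP => y; exact: spec_bond_comp.
Qed.

Definition image_spectrum : inverse_spectrum :=
  InverseSpectrum (spec_inhabited S) (@spec_le_refl S) (@spec_le_trans S)
    (@spec_directed S) fmor_bond_id fmor_bond_comp.

Definition lim_comparison_fun (z : F (spec_lim S)) : spec_prod image_spectrum :=
  fun i : spec_index S => fmor F (spec_lim_proj (S := S) i) z.

Lemma lim_comparison_thread (z : F (spec_lim S)) :
  threads (lim_comparison_fun z).
Proof.
move=> i j ij; rewrite /lim_comparison_fun /= -fmor_comp; congr (fmor F _ z).
by apply/continuousEP => y; exact: spec_lim_projE.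
Qed.

Definition lim_comparison (z : F (spec_lim S)) : spec_lim image_spectrum :=
  exist _ (lim_comparison_fun z) (mem_set (lim_comparison_thread z)).

End ImageSpectrum.

Definition monomorphic (F : comp_functor) : Prop :=
  forall (X Y : compactum) (f : continuousType X Y),
    injective f -> injective (fmor F f).

Definition epimorphic (F : comp_functor) : Prop :=
  forall (X Y : compactum) (f : continuousType X Y),
    set_surj setT setT f -> set_surj setT setT (fmor F f).

Definition continuous_functor (F : comp_functor) : Prop :=
  forall S : inverse_spectrum, homeomorphism (@lim_comparison F S).

Definition skeletal_functor (F : comp_functor) : Prop :=
  forall (X Y : compactum) (f : continuousType X Y),
    open_map f -> set_surj setT setT f -> skeletal (fmor F f).

Definition weight_preserving (F : comp_functor) : Prop :=
  forall X : compactum, infinite_set [set: X] -> weight_le (F X) X.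

Definition bicommutative (X' Y' X Y : Type)
    (f' : X' -> Y') (pX : X' -> X) (pY : Y' -> Y) (f : X -> Y) : Prop :=
  pY \o f' =1 f \o pX /\
  forall x : X, f' @` (pX @^-1` [set x]) = pY @^-1` [set f x].

Definition preserves_finite_1_preimages (F : comp_functor) : Prop :=
  forall (X' Y' X Y : compactum)
    (f' : continuousType X' Y') (pX : continuousType X' X)
    (pY : continuousType Y' Y) (f : continuousType X Y),
    injective f -> injective f' -> bijective pX -> finite_set [set: X] ->
    bicommutative f' pX pY f ->
    bicommutative (fmor F f') (fmor F pX) (fmor F pY) (fmor F f).

Definition functor_1mec (F : comp_functor) : Prop :=
  [/\ monomorphic F, epimorphic F, continuous_functor F &
      preserves_finite_1_preimages F].

Definition functor_1mecw (F : comp_functor) : Prop :=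
  functor_1mec F /\ weight_preserving F.

Section SumWithFinite.
Variable Z : compactum.

(* The topological sum of Z (index [true]) and discrete 'I_n (index [false]). *)
Definition oplus_summand (n : nat) (b : bool) : topologicalType :=
  if b then compactum_space Z else discrete_topology 'I_n.

Lemma oplus_compact n : compact [set: {b : bool & oplus_summand n b}].
Proof.
apply: sigT_compact; first exact: finite_finset.
case=> /=; first exact: compactum_compact.
apply: finite_compact; exact: (@finite_finset 'I_n).
Qed.

Lemma oplus_hausdorff n : hausdorff_space {b : bool & oplus_summand n b}.
Proof.
apply: sigT_hausdorff; case=> /=; first exact: compactum_hausdorff.
exact: discrete_hausdorff.
Qed.

Definition oplus (n : nat) : compactum :=
  Compactum (@oplus_compact n) (@oplus_hausdorff n).

Definition oplus_left n (z : Z) : oplus n :=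
  existT (oplus_summand n) true z.

Definition oplus_right n (i : 'I_n) : oplus n :=
  existT (oplus_summand n) false i.

Definition fold2_fun (x : oplus 2) : oplus 1 :=
  match x with
  | existT true z => oplus_left 1 z
  | existT false _ => oplus_right ord0
  end.

Lemma fold2_continuous : continuous fold2_fun.
Proof.
case=> -[z|k] U /= nU; rewrite /nbhs /= sigT_nbhsE /=.
  exact: (@existT_continuous _ (oplus_summand 1) true z U nU).
exact: (@cvg_cst _ (oplus_right ord0) _ (nbhs k) _ U nU).
Qed.

Definition fold2 : continuousType (oplus 2) (oplus 1) :=
  mkcts fold2_continuous.

End SumWithFinite.

(* Main.v *)
(** Let [f : X -> Y] be an open surjection of compacta. Pull a nonempty open
subset of [FX] back along an irreducible zero-dimensional cover [T0 -> X]; by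
continuity of [F] it is determined by a finite clopen partition
[q : T0 -> Q]. The image in [Y] of each cell of the partition has interior, so
one can choose a closed [T] in [T0] that still meets every cell and is mapped
onto [Y] almost irreducibly: apart from finitely many isolated points of [T],
lying over isolated points of [Y], the map [T -> Y] is irreducible. It is thus a
composition of finitely many maps, each identifying two isolated points (these
are the maps [fold2 Z]), followed by an irreducible map out of a
zero-dimensional compactum. Preservation of finite 1-preimages makes [F] of an
irreducible map skeletal, since irreducible maps have, relative to any finite
clopen partition, a point in each cell whose whole fiber lies in that cell.

For weight-preserving [F], a countable closing-off argument reflects a failure
of skeletality of [F (fold2 Z)] to a metrizable quotient of [Z]. *)
Require Import Defs.
From mathcomp Require Import all_boot all_order all_algebra.
From mathcomp Require Import all_classical all_reals topology.

Set Implicit Arguments.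
Unset Strict Implicit.
Unset Printing Implicit Defensive.

Import Order.TTheory GRing.Theory Num.Theory.

Local Open Scope classical_set_scope.

(** * Compacta: compactness arguments, skeletal maps, subspaces, products and cubes *)

Lemma compactum_closed_compact (X : compactum) (A : set X) :
  closed A -> compact A.
Proof.
by move=> cA; apply: (subclosed_compact cA (@compactum_compact X)); exact: subsetT.
Qed.

Lemma directed_closed_nonempty (X : compactum) (I : Type) (C : I -> set X) :
  inhabited I -> (forall i, closed (C i)) ->
  (forall i, C i !=set0) ->
  (forall i j, exists k, C k `<=` C i `&` C j) ->
  exists x, forall i, C i x.
Proof.
move=> [i0] cC nC dC.
have FF : Filter (filter_from [set: I] C).
  apply: filter_from_filter; first by exists i0.
  by move=> i j _ _; have [k] := dC i j; exists k.
have PF : ProperFilter (filter_from [set: I] C).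
  by apply: filter_from_proper => i _; exact: nC.
have [|x [_ clx]] := @compactum_compact X (filter_from setT C) PF.
  exact: filterT.
exists x => i; apply: cC => U Ux.
by apply: clx => //; exists i.
Qed.

Lemma closed_image (X Y : compactum) (f : continuousType X Y) (A : set X) :
  closed A -> closed (f @` A).
Proof.
move=> cA; apply: compact_closed; first exact: compactum_hausdorff.
apply: continuous_compact; last exact: compactum_closed_compact.
exact/continuous_subspaceT/cts_fun.
Qed.

Lemma closed_point (X : compactum) (x : X) : closed [set x].
Proof.
by apply: compact_closed; [exact: compactum_hausdorff | exact: compact_set1].
Qed.

Lemma open_preim (X Y : compactum) (f : continuousType X Y) (A : set Y) :
  open A -> open (f @^-1` A).
Proof. by move: A; apply/continuousP; exact: cts_fun. Qed.

Lemma closed_preim (X Y : compactum) (f : continuousType X Y) (A : set Y) :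
  closed A -> closed (f @^-1` A).
Proof. by move: A; apply/continuous_closedP; exact: cts_fun. Qed.

Lemma continuous_of_closed (X Y : topologicalType) (f : X -> Y) :
  (forall A, closed A -> closed (f @^-1` A)) -> continuous f.
Proof. by move=> H; apply/continuous_closedP. Qed.

Lemma continuous_inverse (X Y : compactum) (f : continuousType X Y) :
  bijective f -> exists g : continuousType Y X, cancel f g /\ cancel g f.
Proof.
case=> g fK gK; suff cg : continuous g by exists (mkcts cg).
apply: continuous_of_closed => A cA.
suff -> : g @^-1` A = f @` A by exact: closed_image.
apply/seteqP; split=> [y Agy|_ [x Ax <-]]; first by exists (g y).
by rewrite /preimage /= fK.
Qed.

Lemma finite_points_closed (X : compactum) (A : set X) : finite_set A -> closed A.
Proof.
move=> fA; apply: compact_closed; [exact: compactum_hausdorff|exact: finite_compact].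
Qed.

Lemma finite_open (X : compactum) (A : set X) :
  finite_set [set: X] -> open A.
Proof.
move=> fX; rewrite -[A]setCK; apply: closed_openC.
by apply: (@finite_points_closed X); apply: (sub_finite_set _ fX).
Qed.

Lemma finite_continuous (X Y : compactum) (f : X -> Y) :
  finite_set [set: X] -> continuous f.
Proof. by move=> fX; apply/continuousP => A _; exact: finite_open. Qed.

Lemma separate_points (X : compactum) (x y : X) : x <> y ->
  exists A B : set X, [/\ open A, open B, A x, B y & A `&` B = set0].
Proof.
move=> xy; have := @compactum_hausdorff X; rewrite open_hausdorff.
move/(_ x y); case; first exact/eqP.
move=> [A B] /= [/set_mem Ax /set_mem By] [oA oB /eqP AB].
by exists A, B.
Qed.

Lemma closure_min (T : topologicalType) (A C : set T) :
  closed C -> A `<=` C -> closure A `<=` C.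
Proof. by move=> /closure_id cC AC; rewrite [X in _ `<=` X]cC; exact: closureS. Qed.

(** If the image of a nonempty open [U] were nowhere dense, [U] would lie in a nowhere dense
    preimage. Conversely, continuity maps the interior of the closure of the preimage of [A] into
    [closure A], which then contains a nonempty open set. *)
Lemma skeletalP (X Y : compactum) (f : continuousType X Y) :
  skeletal f <-> forall U : set X, open U -> U !=set0 ->
    exists2 V : set Y, open V & V !=set0 /\ V `<=` closure (f @` U).
Proof.
split=> [sf U oU [u Uu]|sf A ndA].
  apply: contrapT => nV.
  have nd : nowhere_dense (f @` U).
    rewrite /nowhere_dense; apply/eqP; apply: contrapT => /negP/set0P nei.
    apply: nV; exists (interior (closure (f @` U))); first exact: open_interior.
    by split => //; exact: interior_subset.
  have /seteqP [+ _] := sf _ nd => /(_ u); apply.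
  apply: (@filterS _ _ _ U); last exact: open_nbhs_nbhs.
  by move=> x Ux; apply: subset_closure; exists x.
apply/seteqP; split => // x ix.
have [|V oV [[y Vy] VU]] := sf (interior (closure (f @^-1` A))) (open_interior _).
  by exists x.
have : interior (closure A) y.
  apply: (@filterS _ _ _ V); last exact: open_nbhs_nbhs.
  apply: (subset_trans VU); apply: closure_min; first exact: closed_closure.
  move=> _ [w /interior_subset clw <-]; move: w clw.
  apply: closure_min; first by apply: closed_preim; exact: closed_closure.
  by move=> t At; exact: subset_closure.
by rewrite [X in X y]ndA.
Qed.

Lemma skeletal_comp (X Y Z : topologicalType) (f : X -> Y) (g : Y -> Z) :
  skeletal f -> skeletal g -> skeletal (g \o f).
Proof. by move=> sf sg A /sg /sf. Qed.

Lemma eq_skeletal (X Y : topologicalType) (f g : X -> Y) :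
  f =1 g -> skeletal f -> skeletal g.
Proof. by move=> /funext ->. Qed.

Lemma closed_subspace_compact (X : compactum) (A : set X) : closed A -> compact [set: A].
Proof. by move=> cA; apply: set_type_compact; exact: compactum_closed_compact. Qed.

Definition subc (X : compactum) (A : set X) (cA : closed A) : compactum :=
  Compactum (closed_subspace_compact cA) (set_type_hausdorff (A := A) (@compactum_hausdorff X)).

Section Subspace.
Variables (X : compactum) (A : set X) (cA : closed A).

Definition subc_val_fun (x : subc cA) : X := set_val x.

Lemma subc_val_continuous : continuous subc_val_fun.
Proof. exact: (@initial_continuous A X set_val). Qed.

Definition subc_val : continuousType (subc cA) X := mkcts subc_val_continuous.

Lemma subc_val_in (x : subc cA) : A (subc_val x).
Proof. exact: set_valP. Qed.

Lemma subc_val_inj : injective subc_val.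
Proof. exact: val_inj. Qed.

Definition subpt (x : X) (Ax : A x) : subc cA := exist _ x (mem_set Ax).

Lemma subc_openP (U : set (subc cA)) :
  open U <-> exists2 V : set X, open V & U = subc_val @^-1` V.
Proof.
split=> [[V oV <-]|[V oV ->]]; first by exists V.
exact: open_preim.
Qed.

Variables (Y : topologicalType) (f : continuousType Y X) (Af : forall y, A (f y)).

Definition corestr_fun (y : Y) : subc cA := subpt (Af y).

Lemma corestr_continuous : continuous corestr_fun.
Proof.
apply/continuousP => U /subc_openP [V oV ->].
suff : open (f @^-1` V) by [].
by move: V oV; apply/continuousP; exact: cts_fun.
Qed.

Definition corestr : continuousType Y (subc cA) := mkcts corestr_continuous.

End Subspace.
Arguments subc_val {X A cA}.
Arguments subc_val_in {X A cA} x.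
Arguments subc_val_inj {X A cA} [x1 x2].
Arguments subpt {X A} cA {x} Ax.
Arguments corestr {X A} cA {Y f} Af.

Lemma hausdorff_prod (X Y : topologicalType) :
  hausdorff_space X -> hausdorff_space Y -> hausdorff_space (X * Y)%type.
Proof.
move=> hX hY p q cl; rewrite [p]surjective_pairing [q]surjective_pairing.
have fstP (r : X * Y) : fst @ r --> r.1 by exact: cvg_fst.
have sndP (r : X * Y) : snd @ r --> r.2 by exact: cvg_snd.
congr (_, _).
  apply: hX => A B Ap Bq.
  by have [z [Az Bz]] := cl _ _ (fstP p A Ap) (fstP q B Bq); exists z.1.
apply: hY => A B Ap Bq.
by have [z [Az Bz]] := cl _ _ (sndP p A Ap) (sndP q B Bq); exists z.2.
Qed.

Lemma preimage_bool_clopen (T : topologicalType) (e : T -> bool) (b : bool) :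
  continuous e -> clopen (e @^-1` [set b]).
Proof.
move=> ce; apply: preimage_clopen => //.
by split; [exact: discrete_open|exact: discrete_closed].
Qed.

Section Product.
Variables X Y : compactum.

Lemma prodc_compact : compact [set: X * Y].
Proof.
rewrite -setXTT; apply: compact_setX; exact: compactum_compact.
Qed.

Definition prodc : compactum := Compactum prodc_compact
  (hausdorff_prod (@compactum_hausdorff X) (@compactum_hausdorff Y)).

Lemma prodc_fst_continuous : continuous (fst : prodc -> X).
Proof. by move=> p; exact: cvg_fst. Qed.

Lemma prodc_snd_continuous : continuous (snd : prodc -> Y).
Proof. by move=> p; exact: cvg_snd. Qed.

Definition prodc_fst : continuousType prodc X := mkcts prodc_fst_continuous.
Definition prodc_snd : continuousType prodc Y := mkcts prodc_snd_continuous.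

Variables (T : topologicalType).
Variables (f : continuousType T X) (g : continuousType T Y).

Lemma prodc_pair_continuous : continuous (fun t => (f t, g t) : prodc).
Proof. by move=> t; apply: cvg_pair; exact: cts_fun. Qed.

Definition prodc_pair : continuousType T prodc := mkcts prodc_pair_continuous.

End Product.

Lemma product_continuous (I : Type) (K : I -> topologicalType)
    (T : topologicalType) (f : T -> prod_topology K) :
  (forall i, continuous (fun t => f t i)) -> continuous f.
Proof.
(* The projections are surjective: [dfwith] prescribes one coordinate of the point [f x]. *)
move=> cf x; apply/cvg_sup => i; apply/cvg_image.
  apply/seteqP; split => // b _.
  by exists (@dfwith {classic I} K (f x) i b); rewrite //= dfwithin.
move=> A Ab; exists [set y | A (y i)]; first exact: (cf i x A Ab).
apply/seteqP; split => [_ [y Ay <-]|b Ab'] //.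
by exists (@dfwith {classic I} K (f x) i b); rewrite /= dfwithin.
Qed.

Section Cube.
Variable I : Type.

Lemma cube_compact : compact [set: prod_topology (fun _ : I => bool)].
Proof.
have := @tychonoff {classic I} (fun=> bool) (fun=> setT) (fun=> bool_compact).
by congr compact; apply/seteqP; split.
Qed.

Lemma cube_hausdorff : hausdorff_space (prod_topology (fun _ : I => bool)).
Proof.
by apply: (@hausdorff_product {classic I} (fun=> bool)) => i; exact: discrete_hausdorff.
Qed.

Definition cube : compactum := Compactum cube_compact cube_hausdorff.

Lemma coord_continuous (i : I) : continuous (fun x : cube => x i : bool).
Proof. exact: (@proj_continuous {classic I} (fun=> bool) i). Qed.

End Cube.

(** * Finite determination of open sets *)

Section Functor.
Variable F : comp_functor.

Lemma eq_fmor (X Y : compactum) (f g : continuousType X Y) (z : F X) :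
  f =1 g -> fmor F f z = fmor F g z.
Proof. by move=> fg; congr (fmor F _ z); apply/continuousEP. Qed.

Lemma fmor_factor (X Y Z : compactum) (f : continuousType X Y)
    (g : continuousType Y Z) (h : continuousType X Z) (z : F X) :
  (forall x, g (f x) = h x) -> fmor F g (fmor F f z) = fmor F h z.
Proof. by move=> gfh; rewrite -fmor_comp; exact: eq_fmor. Qed.

Lemma epi_fmor (X Y : compactum) (f : continuousType X Y) : epimorphic F ->
  (forall y, exists x, f x = y) -> forall y, exists x, fmor F f x = y.
Proof.
move=> eF sf y.
have [|x _ <-] := eF X Y f _ y Logic.I; last by exists x.
by move=> {}y _; have [x <-] := sf y; exists x.
Qed.

(** The map from [X] into the limit is injective, hence so is its image under [F]; the comparison
    map of [F] is injective too. So the maps [fmor F (q i)] together separate the points of [F X].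
    By compactness the fiber of one of them through [x] lies in [U], and this map is closed. *)
Lemma open_determined (S : inverse_spectrum) (X : compactum)
    (q : forall i, continuousType X (spec_space S i)) (U : set (F X)) (x : F X) :
  monomorphic F -> continuous_functor F ->
  (forall i j (ij : spec_le i j) y, spec_bond ij (q j y) = q i y) ->
  (forall y z, (forall i, q i y = q i z) -> y = z) ->
  open U -> U x ->
  exists i, exists W : set (F (spec_space S i)),
    [/\ open W, W (fmor F (q i) x) & fmor F (q i) @^-1` W `<=` U].
Proof.
move=> mF cF qb qI oU Ux.
pose k_fun (y : X) : spec_lim S :=
  exist _ (fun i => q i y) (mem_set ((fun i j ij => qb i j ij y) :
    threads ((fun i => q i y) : spec_prod S))).
have ck : continuous k_fun.
  apply/continuousP => _ [V oV <-].
  suff : open ((fun y => (fun i => q i y) : spec_prod S) @^-1` V) by [].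
  move: V oV; apply/continuousP; apply: product_continuous => i.
  exact: cts_fun.
pose k : continuousType X (spec_lim S) := mkcts ck.
have kI : injective k by move=> y z yz; apply: qI => i; exact: (congr1 (spec_lim_proj i) yz).
have kE i z : fmor F (spec_lim_proj (S := S) i) (fmor F k z) = fmor F (q i) z.
  exact: fmor_factor.
have sepF z z' : (forall i, fmor F (q i) z = fmor F (q i) z') -> z = z'.
  move=> zz'; apply: (mF _ _ _ kI).
  have [_ [g [_ gK _]]] := cF S.
  apply: (can_inj gK); rewrite /lim_comparison; apply: eq_exist.
  apply: functional_extensionality_dep => i.
  by rewrite /lim_comparison_fun !kE zz'.
have cmp i j (ij : spec_le i j) z :
    fmor F (spec_bond ij) (fmor F (q j) z) = fmor F (q i) z.
  by apply: fmor_factor => y; exact: qb.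
(* The part of the fiber through [x] lying outside [U]. If it were never empty, these directed
   closed sets would share a point, which no [fmor F (q i)] could tell from [x]. *)
pose C i := ~` U `&` fmor F (q i) @^-1` [set fmor F (q i) x].
have [[i Ci0]|nC] := pselect (exists i, C i = set0).
  exists i, (~` (fmor F (q i) @` (~` U))); split.
  - by apply: closed_openC; apply: closed_image; exact: open_closedC.
  - move=> [z Uz zx]; have /seteqP [+ _] := Ci0 => /(_ z); exact.
  - by move=> z /= Wz; apply: contrapT => Uz; apply: Wz; exists z.
have [i0 _] := spec_inhabited S.
have [||||z Cz] := @directed_closed_nonempty (F X) _ C.
- exact: (inhabits i0).
- move=> i; apply: closedI; first exact: open_closedC.
  by apply: closed_preim; exact: closed_point.
- by move=> i; apply/set0P/eqP => Ci0; apply: nC; exists i.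
- move=> i j; have [l [il jl]] := spec_directed i j.
  exists l => z [Uz zx]; split; split=> //=.
    by rewrite -(cmp _ _ il) zx cmp.
  by rewrite -(cmp _ _ jl) zx cmp.
have [nUz _] := Cz i0; exfalso; apply: nUz.
by rewrite (_ : z = x) //; apply: sepF => i; have [] := Cz i.
Qed.

End Functor.

(** * Quotients by families of clopen sets, and their spectra *)

Lemma indicator_continuous (T : topologicalType) (C : set T) :
  clopen C -> continuous (fun t => `[<C t>]).
Proof.
move=> [oC cC]; apply/continuousP => A _.
have -> : (fun t => `[<C t>]) @^-1` A =
    (C `&` [set _ | A true]) `|` (~` C `&` [set _ | A false]).
  by apply/seteqP; split=> t /=; case: asboolP => Ct; [left|right|case=> -[]|case=> -[]].
have oc (P : Prop) : open [set _ : T | P].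
  have [p|np] := pselect P.
    have -> : [set _ : T | P] = setT by apply/seteqP; split.
    exact: openT.
  have -> : [set _ : T | P] = set0 by apply/seteqP; split.
  exact: open0.
by apply: openU; apply: openI => //; exact: closed_openC.
Qed.

Section Quotients.
Variable Z : compactum.

(* [quot J] identifies the points lying in the same clopen members of [J]. The
   coordinates outside [J] are set to [false], so that all these quotients live
   in one cube. *)
Definition code_fun (J : set (set Z)) (z : Z) : cube (set Z) :=
  fun C => `[<J C>] && `[<clopen C /\ C z>].

Lemma code_continuous J : continuous (code_fun J).
Proof.
apply: product_continuous => C; rewrite /code_fun.
case: (asboolP (J C)) => _ /=; last exact: cst_continuous.
have [cC|cC] := pselect (clopen C).
  rewrite (_ : (fun t => _) = fun t => `[<C t>]); first exact: indicator_continuous.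
  by apply/funext => t; apply: asbool_equiv_eq; split => // -[].
rewrite (_ : (fun t => _) = fun=> false); first exact: cst_continuous.
by apply/funext => t; apply/asboolP => -[].
Qed.

Definition code J : continuousType Z (cube (set Z)) := mkcts (@code_continuous J).

Lemma code_range_closed J : closed (range (code J)).
Proof. by apply: closed_image; exact: closedT. Qed.

Arguments code_range_closed : clear implicits.

Definition quot J : compactum := subc (code_range_closed J).

Definition quot_map J : continuousType Z (quot J) :=
  corestr (code_range_closed J) (fun z => imageP (code J) Logic.I).

Lemma quot_map_surj J (t : quot J) : exists z, quot_map J z = t.
Proof. by have [z _ zt] := subc_val_in t; exists z; apply: subc_val_inj. Qed.

Lemma quot_mapP J z z' : quot_map J z = quot_map J z' <->
  forall C, J C -> clopen C -> (C z <-> C z').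
Proof.
split=> [zz' C JC cC|H].
  have : code_fun J z C = code_fun J z' C.
    exact: (congr1 (fun t : quot J => subc_val t C) zz').
  rewrite /code_fun (asboolT JC) /= => e; have h := asbool_eq_equiv e.
  by split=> Cz; [have /h [] : clopen C /\ C z by []|have /h [] : clopen C /\ C z' by []].
apply: subc_val_inj; apply/funext => C.
change (code_fun J z C = code_fun J z' C); rewrite /code_fun.
case: (asboolP (J C)) => //= JC; apply: asbool_equiv_eq.
by split=> -[cC Cz]; split=> //; apply/(H C JC cC).
Qed.

(** Induces the bonding maps between the quotients: it is defined and continuous on the whole cube
    and only has to be restricted. *)
Definition trunc_fun (J : set (set Z)) (t : cube (set Z)) : cube (set Z) :=
  fun C => `[<J C>] && t C.

Lemma trunc_continuous J : continuous (trunc_fun J).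
Proof.
apply: product_continuous => C; rewrite /trunc_fun.
by case: (asboolP (J C)) => _ /=; [exact: coord_continuous|exact: cst_continuous].
Qed.

Definition trunc J : continuousType (cube (set Z)) (cube (set Z)) :=
  mkcts (@trunc_continuous J).

Lemma trunc_code J K z : J `<=` K -> trunc J (code K z) = code J z.
Proof.
move=> JK; apply/funext => C.
change (trunc_fun J (code_fun K z) C = code_fun J z C); rewrite /trunc_fun /code_fun.
by case: (asboolP (J C)) => //= JC; rewrite (asboolT (JK _ JC)).
Qed.

Lemma trunc_range J K (JK : J `<=` K) (t : quot K) :
  range (code J) ((trunc J \o subc_val (cA := code_range_closed K)) t).
Proof.
by have [z _ zt] := subc_val_in t; exists z => //=; rewrite -zt trunc_code.
Qed.

Definition quot_bond J K (JK : J `<=` K) : continuousType (quot K) (quot J) :=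
  corestr (code_range_closed J) (trunc_range JK).

Lemma quot_bondE J K (JK : J `<=` K) z : quot_bond JK (quot_map K z) = quot_map J z.
Proof. by apply: subc_val_inj; exact: trunc_code. Qed.

Lemma quot_bond_comp J K L (JK : J `<=` K) (KL : K `<=` L) (JL : J `<=` L)
  (t : quot L) : quot_bond JK (quot_bond KL t) = quot_bond JL t.
Proof. by have [z <-] := quot_map_surj t; rewrite !quot_bondE. Qed.

Lemma finite_quot J : finite_set J -> finite_set [set: quot J].
Proof.
move=> /(@finite_seqP {classic set Z}) [s Js].
pose h (t : quot J) := [tuple of [seq subc_val t C : bool | C <- in_tuple s]].
have hI : injective h.
  move=> t u /(congr1 val) /= tu.
  suff /subc_val_inj : subc_val t = subc_val u by [].
  apply/funext => C.
  have [JC|JC] := pselect (J C).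
    by move/eq_in_map: tu; apply; rewrite Js in JC.
  have out (v : quot J) : subc_val v C = false.
    have [z _ <-] := subc_val_in v.
    by change (code_fun J z C = false); rewrite /code_fun (asboolF JC).
  by rewrite !out.
have -> : [set: quot J] = h @^-1` setT by [].
by apply: finite_preimage; [move=> t u _ _; exact: hI|exact: finite_finset].
Qed.

Lemma quot_zero_dimensional J : zero_dimensional (quot J).
Proof.
move=> t u tu.
have [C tuC] : exists C, subc_val t C <> subc_val u C.
  apply/existsNP => tuE; move/eqP: tu; apply; apply: subc_val_inj.
  exact/funext.
pose e (v : quot J) : bool := subc_val v C.
have ce : continuous e.
  move=> v; apply: (@continuous_comp _ _ _ (subc_val (cA := @code_range_closed J))
    (fun x : cube (set Z) => x C : bool)).
    exact: cts_fun.
  exact: coord_continuous.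
exists (e @^-1` [set subc_val t C]); split=> //; last exact/nesym.
exact: preimage_bool_clopen.
Qed.

Section Spectrum.
Variable D : set (set Z).

(** Two choices of [D] matter: [setT], where the finite quotients approximate a zero-dimensional
    [Z], and a countable family, where they approximate the metrizable [quot D]. *)
Definition qindex := {J : set (set Z) | finite_set J /\ J `<=` D}.

Definition qle (J K : qindex) := sval J `<=` sval K.

Lemma qinhabited : exists J : qindex, True.
Proof.
have H : finite_set (set0 : set (set Z)) /\ set0 `<=` D by split.
by exists (exist _ set0 H).
Qed.

Lemma qdirected (J K : qindex) : exists L, qle J L /\ qle K L.
Proof.
case: J K => [J [fJ JD]] [K [fK KD]].
have H : finite_set (J `|` K) /\ (J `|` K) `<=` D.
  by split; [rewrite finite_setU|move=> C [/JD|/KD]].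
exists (exist _ (J `|` K) H); split => C HC; [by left|by right].
Qed.

Lemma qbond_id (J : qindex) (JJ : qle J J) (t : quot (sval J)) :
  quot_bond JJ t = t.
Proof. by have [z <-] := quot_map_surj t; rewrite quot_bondE. Qed.

Lemma qbond_comp (J K L : qindex) (JK : qle J K) (KL : qle K L) (JL : qle J L)
  (t : quot (sval L)) : quot_bond JK (quot_bond KL t) = quot_bond JL t.
Proof. exact: quot_bond_comp. Qed.

Definition quot_spectrum : inverse_spectrum :=
  InverseSpectrum qinhabited (fun J => @subset_refl _ (sval J))
   (fun J K L => @subset_trans _ (sval K) (sval J) (sval L)) qdirected qbond_id qbond_comp.

End Spectrum.

Lemma quot_maps_separate : zero_dimensional Z ->
  forall y z, (forall J : qindex setT, quot_map (sval J) y = quot_map (sval J) z) ->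
  y = z.
Proof.
move=> zZ y z yz; apply: contrapT => /eqP /zZ [C [cC Cy Cz]].
have H : finite_set [set C] /\ [set C] `<=` setT by split.
have /quot_mapP /(_ C erefl cC) [+ _] := yz (exist _ _ H).
by move=> /(_ Cy).
Qed.

Lemma quot_bonds_separate (D : set (set Z)) (t u : quot D) :
  (forall J : qindex D, quot_bond (proj2 (svalP J)) t = quot_bond (proj2 (svalP J)) u) ->
  t = u.
Proof.
have [y <-] := quot_map_surj t; have [z <-] := quot_map_surj u => yz.
apply/quot_mapP => C DC cC.
have H : finite_set [set C] /\ [set C] `<=` D by split=> // _ ->.
have := yz (exist _ _ H); rewrite !quot_bondE => /quot_mapP.
by move=> /(_ C erefl cC).
Qed.

End Quotients.

Lemma open_determined_quot (F : comp_functor) (Z : compactum) (U : set (F Z)) (x : F Z) :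
  monomorphic F -> continuous_functor F -> zero_dimensional Z -> open U -> U x ->
  exists J : set (set Z), finite_set J /\ exists W : set (F (quot J)),
    [/\ open W, W (fmor F (quot_map J) x) & fmor F (quot_map J) @^-1` W `<=` U].
Proof.
move=> mF cF zZ oU Ux.
have [||||J [W HW]] := @open_determined F (quot_spectrum setT) Z
  (fun J => quot_map (sval J)) U x mF cF.
- by move=> J K JK z; rewrite /= quot_bondE.
- exact: quot_maps_separate.
- exact: oU.
- exact: Ux.
by exists (sval J); split; [exact: (proj1 (svalP J))|exists W].
Qed.

(** * Irreducible maps and folding maps *)

(** The condition on [O] is irreducibility of [h]. Let [q] be a finite clopen partition determining
    [U], and [phi c] a point whose fiber lies in the cell [c]. The image of [T] under [(q, h)] has a
    single point over [phi c]. Preservation of finite 1-preimages transfers this to [F]: all points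
    over the image of [fmor F q x] are sent into [W], and by compactness so are those over a
    neighborhood. *)
Lemma skeletal_irreducible (F : comp_functor) (T Y : compactum)
    (h : continuousType T Y) :
  functor_1mec F -> zero_dimensional T ->
  (forall y, exists t, h t = y) ->
  (forall O : set T, open O -> O !=set0 -> exists y, forall t, h t = y -> O t) ->
  skeletal (fmor F h).
Proof.
move=> [mF eF cF pF] zT hS hI; apply/skeletalP => U oU [x Ux].
have [J [fJ [W [oW Wx WU]]]] := open_determined_quot mF cF zT oU Ux.
set q := quot_map J in Wx WU *.
have fQ := finite_quot fJ.
have /choice [phi phiP] : forall c, exists y, forall t, h t = y -> q t = c.
  move=> c; apply: (hI (q @^-1` [set c])).
    by apply: open_preim; exact: finite_open.
  by have [t <-] := quot_map_surj c; exists t.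
(* The square [Q -> range (q, h)], [Q -> Y] is bicommutative: the only point of
   the range over [phi c] is [(c, phi c)]. *)
have cR : closed (range (prodc_pair q h)) by apply: closed_image; exact: closedT.
pose r := corestr cR (fun t => imageP (prodc_pair q h) (Logic.I : setT t)).
pose p1 : continuousType (subc cR) (quot J) := prodc_fst (quot J) Y \o subc_val.
pose p2 : continuousType (subc cR) Y := prodc_snd (quot J) Y \o subc_val.
have cphi : continuous phi by exact: finite_continuous.
pose phic : continuousType (quot J) Y := mkcts cphi.
have graph c : range (prodc_pair q h) (prodc_pair idfun phic c).
  have [t ht] := hS (phi c); exists t => //.
  by change ((q t, h t) = (c, phi c)); rewrite ht (phiP _ _ ht).
pose sg := corestr cR graph.
have fiber s c : p2 s = phi c -> s = sg c.
  move=> sc; apply: subc_val_inj; have [t _ ts] := subc_val_in s.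
  have hts : h t = phi c by rewrite -sc /= /p2 /= -ts.
  by rewrite -ts; change ((q t, h t) = (c, phi c)); rewrite hts (phiP _ _ hts).
have [] := pF _ _ _ _ sg idfun p2 phic _ _ _ fQ.
- move=> c d cd; have [t ht] := hS (phi c).
  by rewrite -(phiP _ _ ht); apply: phiP; rewrite ht.
- by move=> c d /(congr1 p1).
- by exists idfun.
- split=> // c; apply/seteqP; split=> [_ [d <- <-]|s /= /fiber ->] //.
  by exists c.
move=> _ /(_ (fmor F q x)) fibF.
(* By bicommutativity such a [z] is the image of [fmor F q x] under [fmor F sg], and [p1] undoes
   [sg]. *)
have nearb z : fmor F p2 z = fmor F phic (fmor F q x) -> W (fmor F p1 z).
  move=> zb; have /seteqP [_ /(_ z)] := fibF.
  move=> [//|w /= wx <-].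
  have ww : w = fmor F q x by rewrite -wx; exact/esym/fmor_id.
  by rewrite (fmor_factor (h := idfun)) // fmor_id ww.
(* The points whose whole fiber under [fmor F p2] is sent into [W]; an open set because [fmor F p2]
   is closed. *)
exists (~` (fmor F p2 @` (fmor F p1 @^-1` (~` W)))).
  by apply: closed_openC; apply: closed_image; apply: closed_preim; exact: open_closedC.
split; first by exists (fmor F phic (fmor F q x)) => -[z /= nW] /nearb.
move=> y Vy; apply: subset_closure.
have [t ty] := epi_fmor eF hS y; exists t => //; apply: WU => /=.
apply: contrapT => nWt; apply: Vy; exists (fmor F r t).
  by rewrite /= (fmor_factor (h := q)).
by rewrite (fmor_factor (h := h)).
Qed.

(** The arguments use separation of points by clopen sets, the theorem speaks of clopen bases; on
    compacta the two notions agree, by this lemma and the next. *)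
Lemma zero_dimensional_zero_dim (X : compactum) : zero_dimensional X -> zero_dim X.
Proof.
move=> zX; exists (@clopen X) => //; split; first by move=> C [].
move=> x; have := @zero_dimensional_cvg X x (@compactum_hausdorff X) zX
  (@compactum_compact X).
move=> cvgx U /cvgx [C [Cx cC] CU].
by exists C.
Qed.

Lemma zero_dim_zero_dimensional (X : compactum) : zero_dim X -> zero_dimensional X.
Proof.
move=> [B [oB cvB] Bc] x y /eqP xy.
have [U [V [oU oV Ux Vy UV0]]] := separate_points xy.
have [C [BC Cx] CU] := cvB x U (open_nbhs_nbhs (conj oU Ux)).
exists C; split=> //; first exact: Bc.
by move=> /CU Uy; have /seteqP [+ _] := UV0 => /(_ y); apply.
Qed.

Lemma zero_dimensional_inj (X Y : compactum) (f : continuousType X Y) :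
  injective f -> zero_dimensional Y -> zero_dimensional X.
Proof.
move=> fI zY x y /eqP xy.
have /zY [C [cC Cx Cy]] : f x != f y by apply/eqP => /fI.
by exists (f @^-1` C); split => //; apply: preimage_clopen => //; exact: cts_fun.
Qed.

Lemma bijective_of_surj (X Y : Type) (f : X -> Y) :
  injective f -> (forall y, exists x, f x = y) -> bijective f.
Proof.
move=> fI /choice [g gK]; exists g => // x; exact: fI.
Qed.

Lemma skeletal_fmor_bij (F : comp_functor) (X Y : compactum) (f : continuousType X Y) :
  bijective f -> skeletal (fmor F f).
Proof.
move=> /continuous_inverse [g [fK gK]].
apply/skeletalP => U oU [u Uu]; exists (fmor F g @^-1` U).
  exact: open_preim.
split; first by exists (fmor F f u); rewrite /= (fmor_factor (h := idfun)) ?fmor_id.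
move=> y Uy; apply: subset_closure; exists (fmor F g y) => //.
by rewrite (fmor_factor (h := idfun)) ?fmor_id.
Qed.

Section OplusRec.
Variables (Z X : compactum) (n : nat) (f : continuousType Z X) (p : 'I_n -> X).

Definition oplus_rec_fun (x : oplus Z n) : X :=
  match x with
  | existT true z => f z
  | existT false i => p i
  end.

Lemma oplus_rec_continuous : continuous oplus_rec_fun.
Proof.
case=> -[z|k] U /= nU; rewrite /nbhs /= sigT_nbhsE /=.
  exact: (@cts_fun _ _ f z U nU).
apply: (@filterS _ (nbhs k) _ [set k]); last exact: (@discrete_set1 (discrete_topology 'I_n)).
by move=> _ ->; exact: nbhs_singleton nU.
Qed.

Definition oplus_rec : continuousType (oplus Z n) X := mkcts oplus_rec_continuous.

Lemma oplusP (x : oplus Z n) :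
  (exists z, x = oplus_left n z) \/ (exists i, x = @oplus_right Z n i).
Proof. by case: x => -[] x; [left|right]; exists x. Qed.

Lemma oplus_rec_left z : oplus_rec (oplus_left n z) = f z.
Proof. by []. Qed.

Lemma oplus_rec_right i : oplus_rec (@oplus_right Z n i) = p i.
Proof. by []. Qed.

End OplusRec.

(** Let [Z] be [T] without [d] and [d']. Then [T] is [Z] with two points added and [T'] is [Z] with
    one point added, and these homeomorphisms turn [g] into [fold2 Z]. *)
Lemma skeletal_fold_pair (F : comp_functor) (T T' : compactum)
    (g : continuousType T T') (d d' : T) :
  (forall Z : compactum, zero_dim Z -> skeletal (fmor F (fold2 Z))) ->
  zero_dimensional T -> open [set d] -> open [set d'] -> d <> d' ->
  g d = g d' -> (forall y, exists x, g x = y) ->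
  (forall x y, g x = g y -> x = y \/ (x = d \/ x = d') /\ (y = d \/ y = d')) ->
  skeletal (fmor F g).
Proof.
move=> HF zT od od' dd' gdd' gS gI.
have cA : closed (~` ([set d] `|` [set d'])) by apply: open_closedC; exact: openU.
pose a := oplus_rec (subc_val : continuousType (subc cA) T)
  (fun i : 'I_2 => if i == ord0 then d else d').
pose b := oplus_rec (g \o subc_val : continuousType (subc cA) T')
  (fun i : 'I_1 => g d).
have inA (z : subc cA) : subc_val z <> d /\ subc_val z <> d'.
  by have nz := subc_val_in z; split => e; apply: nz; [left|right].
have I2 (i : 'I_2) : i <> ord0 -> i = ord_max.
  by case: i => -[|[|//]] /= lt_i i0; apply: val_inj => //; exfalso; apply: i0; exact: val_inj.
have aB : bijective a.
  apply: bijective_of_surj.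
    move=> x y; rewrite /a.
    have [[z ->]|[i ->]] := oplusP x; have [[w ->]|[j ->]] := oplusP y;
      rewrite !(oplus_rec_left, oplus_rec_right).
    - by move=> zw; congr oplus_left; exact: subc_val_inj zw.
    - by have [zd zd'] := inA z; case: ifP => _ /= ?.
    - by have [wd wd'] := inA w; case: ifP => _ /esym ?.
    - case: eqP => [->|/I2 ->]; case: eqP => [->|/I2 ->] //.
      by move/esym.
  move=> t; have [->|td] := pselect (t = d).
    by exists (@oplus_right (subc cA) 2 ord0).
  have [->|td'] := pselect (t = d').
    by exists (@oplus_right (subc cA) 2 ord_max).
  have At : (~` ([set d] `|` [set d'])) t by case.
  by exists (@oplus_left (subc cA) 2 (subpt cA At)).
have bB : bijective b.
  apply: bijective_of_surj.
    move=> x y; rewrite /b.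
    have [[z ->]|[i ->]] := oplusP x; have [[w ->]|[j ->]] := oplusP y;
      rewrite !(oplus_rec_left, oplus_rec_right).
    - move=> /gI [zw|[zd _]]; first by congr oplus_left; exact: subc_val_inj zw.
      by have [? ?] := inA z; case: zd.
    - move=> /gI [zwd|[zd _]]; first by have [nd _] := inA z; case: nd; exact: zwd.
      by have [? ?] := inA z; case: zd.
    - move=> /gI [zwd|[_ wd]]; first by have [nd _] := inA w; case: nd; exact: esym zwd.
      by have [? ?] := inA w; case: wd.
    - by rewrite (ord1 i) (ord1 j).
  move=> y; have [t <-] := gS y.
  have [td|td] := pselect (t = d \/ t = d').
    exists (@oplus_right (subc cA) 1 ord0); rewrite /b oplus_rec_right.
    by case: td => ->.
  by exists (@oplus_left (subc cA) 1 (subpt cA td)).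
have [a' [aK a'K]] := continuous_inverse aB.
have a'B : bijective a' by exists a.
have comm x : b (fold2 (subc cA) (a' x)) = g x.
  rewrite -{2}(a'K x); have [[z ->]|[i ->]] := oplusP (a' x) => //.
  rewrite /a oplus_rec_right; change (g d = g (if i == ord0 then d else d')).
  by case: ifP.
apply: (@eq_skeletal _ _ (fmor F b \o (fmor F (fold2 (subc cA)) \o fmor F a'))).
  move=> z /=.
  rewrite -fmor_comp; apply: fmor_factor => x; exact: comm.
apply: skeletal_comp; last exact: skeletal_fmor_bij.
apply: skeletal_comp; first exact: skeletal_fmor_bij.
apply: HF; apply: zero_dimensional_zero_dim.
by apply: (zero_dimensional_inj (f := subc_val)) => //; exact: subc_val_inj.
Qed.

Lemma retract_continuous (T : compactum) (d d' : T) : open [set d'] ->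
  continuous (fun t => if t == d' then d else t).
Proof.
move=> od'; apply/continuousP => A oA.
have [Ad|nAd] := pselect (A d).
  rewrite (_ : _ @^-1` _ = A `|` [set d']); first exact: openU.
  apply/seteqP; split=> t /=.
    by have [->|_ At] := eqVneq t d'; [right|left].
  by have [//|td] := eqVneq t d' => -[//|td']; rewrite td' eqxx in td.
rewrite (_ : _ @^-1` _ = A `&` ~` [set d']).
  by apply: openI => //; apply: closed_openC; exact: closed_point.
apply/seteqP; split=> t /=; first by have [//|/eqP td] := eqVneq t d'.
by have [->|//] := eqVneq t d' => -[_]; case.
Qed.

Section AlmostIrreducible.
Variables (F : comp_functor) (T Y : compactum) (h : continuousType T Y) (D : set T).
Hypotheses (F1 : functor_1mec F)
  (HF : forall Z : compactum, zero_dim Z -> skeletal (fmor F (fold2 Z)))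
  (zT : zero_dimensional T) (fD : finite_set D) (oD : forall d, D d -> open [set d])
  (hI : forall O : set T, open O -> O !=set0 -> O `<=` ~` D ->
     exists y, forall t, h t = y -> O t)
  (hD : forall d t, D d -> h t = h d -> D t).

(** Induction on the exceptional points [s] still present in [A]. If two of them have the same
    image, the map factors through the retraction sending one to the other, which folds a pair of
    isolated points. If none do, the restriction of [h] to [A] is irreducible. *)
Lemma skeletal_restrict (n : nat) (s : seq T) (A : set T) (cA : closed A) :
  (size s < n)%N -> (forall t, t \in s -> D t) ->
  A = ~` D `|` [set` s] -> (forall y, exists2 t, A t & h t = y) ->
  skeletal (fmor F (h \o subc_val : continuousType (subc cA) Y)).
Proof.
elim: n s A cA => [//|n IH] s A cA sn sD As hA.
have zA : zero_dimensional (subc cA).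
  by apply: (zero_dimensional_inj (f := subc_val)) => //; exact: subc_val_inj.
have [[d [d' [ds ds' dd' hdd']]]|inj] := pselect (exists d d',
  [/\ d \in s, d' \in s, d <> d' & h d = h d']).
  (* This removes every copy of [d'], so the length may drop by more than one; hence a bound on the
     size of [s] in the induction. *)
  pose s' := [seq t <- s | t != d'].
  pose A' := ~` D `|` [set` s'].
  have oC : open (~` A').
    rewrite (_ : ~` A' = \bigcup_(t in D `&` ~` [set` s']) [set t]).
      by apply: bigcup_open => t [Dt _]; exact: oD.
    apply/seteqP; split=> [t /= nA|t [u [Du su] ->] /=]; last by case.
    exists t => //; split; last by move=> ?; apply: nA; right.
    by apply: contrapT => nDt; apply: nA; left.
  have cA' : closed A' by rewrite -[A']setCK; exact: open_closedC.
  have ds'' : d \in s' by rewrite mem_filter ds andbT; exact/eqP.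
  have rA (t : subc cA) : A' ((mkcts (@retract_continuous T d d' (oD (sD _ ds'))) \o
     (subc_val : continuousType (subc cA) T)) t).
    change (A' (if subc_val t == d' then d else subc_val t)).
    have [_|td] := eqVneq (subc_val t) d'; first by right.
    have AE u : A u -> ~ D u \/ u \in s by rewrite As.
    have [nDt|ts] := AE _ (subc_val_in t); first by left.
    by right; rewrite /= mem_filter td.
  pose g := corestr cA' rA.
  have gE t : subc_val (g t) = if subc_val t == d' then d else subc_val t by [].
  have AA' t : A' t -> A t.
    rewrite As => -[|/=]; first by left.
    by rewrite mem_filter => /andP [_ ts]; right.
  have Ad : A d by rewrite As; right.
  have Ad' : A d' by rewrite As; right.
  have nA'd' : ~ A' d'.
    case; first by apply; exact: (sD _ ds').
    by rewrite /= mem_filter eqxx.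
  apply: (@eq_skeletal _ _ (fmor F (h \o subc_val : continuousType (subc cA') Y) \o fmor F g)).
    move=> z; apply: fmor_factor => x; change (h (subc_val (g x)) = h (subc_val x)).
    by rewrite gE;  have [->|//] := eqVneq (subc_val x) d'.
  have single t (At : A t) : D t -> open [set subpt cA At].
    move=> Dt; apply/subc_openP; exists [set t]; first exact: oD.
    apply/seteqP; split=> [_ ->|x /= xt] //.
    exact: subc_val_inj.
  apply: skeletal_comp.
    apply: (@skeletal_fold_pair F _ _ g (subpt cA Ad) (subpt cA Ad')) => //.
    - by apply: single; exact: (sD _ ds).
    - by apply: single; exact: (sD _ ds').
    - by move/(congr1 subc_val).
    - apply: subc_val_inj; rewrite !gE /= eqxx.
      by have [//|_] := eqVneq d d'.
    - move=> y; have A'y := subc_val_in y.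
      exists (subpt cA (AA' _ A'y)); apply: subc_val_inj; rewrite gE /=.
      have [yd'|//] := eqVneq (subc_val y) d'; exfalso; apply: nA'd'.
      by rewrite -yd'.
    - move=> x y /(congr1 subc_val); rewrite !gE.
      have [xd'|xd'] := eqVneq (subc_val x) d';
        have [yd'|yd'] := eqVneq (subc_val y) d'.
      + by left; apply: subc_val_inj; rewrite xd' yd'.
      + by move=> dy; right; split; [right|left]; apply: subc_val_inj.
      + by move=> dx; right; split; [left|right]; apply: subc_val_inj.
      + by move=> xy; left; exact: subc_val_inj.
  apply: (IH s') => //.
  - rewrite ltnS in sn; apply: leq_trans sn; rewrite size_filter -(count_predC (pred1 d') s).
    by rewrite -[X in (X < _)%N]add0n ltn_add2r -has_count has_pred1.
  - by move=> t; rewrite mem_filter => /andP [_ /sD].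
  - move=> y; have [t At ty] := hA y.
    have [td'|td'] := pselect (t = d').
      by exists d; [right|rewrite hdd' -td'].
    exists t => //; move: At; rewrite As => -[|ts]; first by left.
    by right; rewrite /= mem_filter; apply/andP; split => //; exact/eqP.
apply: skeletal_irreducible => //.
  by move=> y; have [t At ty] := hA y; exists (subpt cA At).
move=> O /subc_openP [V oV OV] [o Oo].
have Vo : V (subc_val o) by rewrite OV in Oo.
have AE u : A u -> ~ D u \/ u \in s by rewrite As.
(* If [o] lies in [D], its fiber in [A] is [o] alone: [hD] keeps the fiber inside [D], and [h] is
   injective on [s]. Otherwise [hI] applies to the open set without the finite, hence closed, set
   [D]. *)
have [Do|nDo] := pselect (D (subc_val o)).
  exists (h (subc_val o)) => t /= hto; suff -> : t = o by [].
  have Dt : D (subc_val t) by exact: hD Do hto.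
  apply: subc_val_inj; apply: contrapT => to.
  have [//|ts] := AE _ (subc_val_in t); have [//|os] := AE _ (subc_val_in o).
  by apply: inj; exists (subc_val t), (subc_val o).
have [|||y yV] := hI (O := V `&` ~` D).
- by apply: openI => //; apply: closed_openC; exact: finite_points_closed.
- by exists (subc_val o).
- by move=> t [].
by exists y => t /yV [Vt _]; rewrite OV.
Qed.

Lemma skeletal_almost_irreducible :
  (forall y, exists t, h t = y) -> skeletal (fmor F h).
Proof.
move=> hS; have [s Ds] := (finite_seqP D).1 fD.
have sk : skeletal (fmor F (h \o subc_val : continuousType (subc (@closedT T)) Y)).
  apply: (@skeletal_restrict (size s).+1 s) => //.
  - by move=> t ts; rewrite Ds.
  - by apply/seteqP; split=> // t _; have [Dt|] := pselect (D t); [right; rewrite Ds in Dt|left].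
  - by move=> y; have [t] := hS y; exists t.
pose i : continuousType (subc (@closedT T)) T := subc_val.
have iB : bijective i.
  apply: bijective_of_surj; first exact: subc_val_inj.
  by move=> t; exists (subpt (@closedT T) (Logic.I : setT t)).
have [j [iK jK]] := continuous_inverse iB.
apply: (@eq_skeletal _ _ (fmor F (h \o i : continuousType _ _) \o fmor F j)).
  by move=> z; apply: fmor_factor => x; rewrite /= jK.
by apply: skeletal_comp => //; apply: skeletal_fmor_bij; exists i.
Qed.

End AlmostIrreducible.

(** * Open surjections *)

(** Zorn's lemma for the open sets whose removal from [K] keeps the image. Along a chain this
    persists: in each fiber the remaining closed sets are directed and nonempty, so they share a
    point. Minimality makes [h] irreducible on [Z]. *)
Lemma minimal_closed_preimage (X Y : compactum) (h : continuousType X Y) (K : set X) :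
  closed K -> exists Z : set X, [/\ closed Z, Z `<=` K, h @` Z = h @` K &
    forall C, closed C -> C `<=` Z -> h @` C = h @` K -> C = Z].
Proof.
move=> cK.
have [F FP totF|O [[oO hO] Omax]] :=
  @Zorn_bigcup X [set O | open O /\ h @` (K `\` O) = h @` K].
  split; first by apply: bigcup_open => O /FP [].
  apply/seteqP; split=> [y [x [Kx _] <-]|y [x0 Kx0 yx0]]; first by exists x.
  (* The empty chain is treated apart, since the compactness argument needs an index. *)
  have [[O0 FO0]|nF] := pselect (exists O, F O); last first.
    by exists x0 => //; split=> // -[O FO _]; apply: nF; exists O.
  pose C (O : {O | F O}) := (K `\` sval O) `&` h @^-1` [set y].
  have [||||x Cx] := @directed_closed_nonempty X _ C.
  - by constructor; exists O0.
  - move=> [O FO]; apply: closedI.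
      by apply: closedI => //; apply: open_closedC; have [] := FP _ FO.
    by apply: closed_preim; exact: closed_point.
  - move=> [O FO]; have [_ hO] := FP _ FO.
    have : (h @` (K `\` O)) y by rewrite hO; exists x0.
    by case=> x KOx xy; exists x.
  - move=> [O FO] [O' FO'].
    have [OO'|O'O] := totF _ _ FO FO'.
      by exists (exist _ O' FO') => x [[Kx O'x] xy]; split; split=> //; split=> // /OO'.
    by exists (exist _ O FO) => x [[Kx O'x] xy]; split; split=> //; split=> // /O'O.
  have [[Kx _] xy] := Cx (exist _ O0 FO0).
  exists x => //; split=> // -[O FO Ox].
  by have [[_ +] _] := Cx (exist _ O FO).
exists (K `\` O); split=> //.
  by apply: closedI => //; exact: open_closedC.
move=> C cC CZ hC; apply/seteqP; split=> // x [Kx nOx].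
apply: contrapT => nCx.
apply: (Omax (~` C)); last first.
  split; first exact: closed_openC.
  rewrite -hC; congr (_ @` _); apply/seteqP; split=> [z [_ /contrapT]|z Cz] //.
  by split; [have [] := CZ _ Cz|].
split; last by move=> /(_ x nCx).
by move=> z Oz Cz; have [_] := CZ _ Cz.
Qed.

(* The first projection of the closure of [{(x, (x \in A)_A)}] in
   [X * 2^(set X)] has a zero-dimensional domain: a point [(x, a)] of it is
   determined by [a], as [a] takes the value 1 on each neighbourhood of [x] and
   0 on each open set whose closure misses [x]. *)
Lemma irreducible_cover (X : compactum) :
  exists (T : compactum) (p : continuousType T X),
    [/\ zero_dimensional T, forall x, exists t, p t = x &
      forall O : set T, open O -> O !=set0 -> exists x, forall t, p t = x -> O t].
Proof.
pose P := prodc X (cube (set X)).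
pose G (x : X) : P := (x, fun A => `[<A x>]).
pose p0 := prodc_fst X (cube (set X)).
pose co (A : set X) (u : P) : bool := u.2 A.
have cco A : continuous (co A).
  move=> u; apply: (@continuous_comp _ _ _ (prodc_snd X (cube (set X)))
    (fun x : cube (set X) => x A : bool)).
    exact: cts_fun.
  exact: coord_continuous.
have clco A b : clopen (co A @^-1` [set b]) by exact: preimage_bool_clopen.
(* A coordinate that is constant on the graph over an open set keeps its value on the closure of the
   graph over that set. *)
have Kco (A O : set X) b : open O -> (forall x, O x -> `[<A x>] = b) ->
    forall u, closure (range G) u -> O u.1 -> co A u = b.
  move=> oO AOb u Ku Ou; apply: contrapT => ub.
  have cl : closed (~` (p0 @^-1` O `&` ~` (co A @^-1` [set b]))).
    apply: open_closedC; apply: openI; first exact: open_preim.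
    by apply: closed_openC; have [] := clco A b.
  apply: (closure_min cl _ Ku) => //.
  by move=> _ [x _ <-] [Ox]; apply; exact: AOb.
have [Z [cZ ZK hZ Zmin]] := minimal_closed_preimage p0 (@closed_closure _ (range G)).
have p0K : p0 @` closure (range G) = setT.
  by apply/seteqP; split=> // x _; exists (G x) => //; apply: subset_closure; exists x.
exists (subc cZ), (p0 \o subc_val : continuousType (subc cZ) X).
split.
- move=> s t /eqP st.
  have [A stA] : exists A, co A (subc_val s) <> co A (subc_val t).
    apply/existsNP => stE; apply: st; apply: subc_val_inj.
    have ZKs := ZK _ (subc_val_in s); have ZKt := ZK _ (subc_val_in t).
    move: stE ZKs ZKt; case: (subc_val s) => x a; case: (subc_val t) => y b stE xa yb.
    congr (_, _); last by apply/funext => A; exact: stE.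
    apply: contrapT => /separate_points [O [O' [oO oO' Ox O'y OO']]].
    have e1 : co O (x, a) = true by apply: (Kco O O) => // z Oz; exact/asboolP.
    have e2 : co O (y, b) = false.
      apply: (Kco O O') => // z O'z; apply/asboolP => Oz.
      by have /seteqP [+ _] := OO' => /(_ z); exact.
    by have := stE O; rewrite e1 e2.
  exists (subc_val @^-1` (co A @^-1` [set co A (subc_val s)])); split=> //.
    by apply: preimage_clopen => //; exact: cts_fun.
  exact/nesym.
- move=> x; have : (p0 @` Z) x by rewrite hZ p0K.
  by move=> [u Zu ux]; exists (subpt cZ Zu).
(* If [O] contained no whole fiber, its complement would still map onto [X], against the minimality
   of [Z]. *)
move=> O oO [o Oo]; apply: contrapT => nO.
pose C := subc_val @` (~` O).
have CZ : C = Z.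
  apply: Zmin.
  - by apply: closed_image; exact: open_closedC.
  - by move=> _ [t _ <-]; exact: subc_val_in.
  - rewrite p0K; apply/seteqP; split=> // x _; apply: contrapT => nx.
    apply: nO; exists x => t tx; apply: contrapT => nOt; apply: nx.
    by exists (subc_val t) => //; exists t.
have : C (subc_val o) by rewrite CZ; exact: subc_val_in.
by case=> t nOt /subc_val_inj to; rewrite to in nOt.
Qed.

Lemma open_all_seq (Y : topologicalType) (C : eqType) (s : seq C) (A : C -> set Y) :
  (forall c, c \in s -> open (A c)) ->
  open [set y | forall c, c \in s -> A c y].
Proof.
elim: s => [_|c s IH oA].
  by rewrite (_ : [set _ | _] = setT); [exact: openT|apply/seteqP; split].
rewrite (_ : [set _ | _] = A c `&` [set y | forall c, c \in s -> A c y]).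
  apply: openI; first by apply: oA; rewrite mem_head.
  by apply: IH => d ds; apply: oA; rewrite inE ds orbT.
apply/seteqP; split=> [y Ay|y [Ac As] d].
  by split=> [|d ds]; apply: Ay; rewrite inE ?eqxx ?ds ?orbT.
by rewrite inE => /orP [/eqP ->|/As].
Qed.

(** To add a new set [G c], fix a point [y] in it. Each earlier [V d] contains a point other than
    [y], as otherwise [y] would be isolated. Separating the two points by disjoint open sets, [V d]
    is cut down to the side away from [y], and [V c] is taken on the side of [y] for every [d]. *)
Lemma disjoint_refinement (Y : compactum) (C : eqType) (s : seq C) (G : C -> set Y) :
  (forall c, c \in s ->
    [/\ open (G c), G c !=set0 & forall y, G c y -> ~ open [set y]]) ->
  exists V : C -> set Y,
    (forall c, c \in s -> [/\ open (V c), V c !=set0 & V c `<=` G c]) /\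
    (forall c d y, c \in s -> d \in s -> V c y -> V d y -> c = d).
Proof.
elim: s => [_|c s IH HG]; first by exists G.
have [d ds|V [HV Vdis]] := IH; first by apply: HG; rewrite inE ds orbT.
have [cs|cs] := boolP (c \in s).
  have E d : d \in c :: s -> d \in s by rewrite inE => /orP [/eqP ->|].
  by exists V; split=> [d /E /HV|d e y /E ds /E es] //; exact: Vdis.
have [oGc [y Gy] isoG] := HG c (mem_head c s).
have /choice [AB HAB] : forall d, exists AB : set Y * set Y, d \in s ->
    [/\ open AB.1, open AB.2, AB.1 y, V d `&` AB.2 !=set0 & AB.1 `&` AB.2 = set0].
  move=> d; have [ds|nds] := boolP (d \in s); last by exists (set0, set0).
  have [oV [v Vv] VG] := HV d ds.
  have [w Vw wy] : exists2 w, V d w & y <> w.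
    apply: contrapT => nw; apply: (isoG _ Gy).
    have Vy w : V d w -> w = y.
      by move=> Vw; apply: contrapT => wy; apply: nw; exists w => //; exact: nesym.
    rewrite (_ : [set y] = V d) //; apply/seteqP; split=> [_ ->|w /Vy //].
    by rewrite -(Vy _ Vv).
  have [A [B [oA oB Ay Bw AB0]]] := separate_points wy.
  by exists (A, B) => _; split=> //; exists w.
pose V' e := if e == c then G c `&` [set y | forall d, d \in s -> (AB d).1 y]
  else V e `&` (AB e).2.
have V'c : V' c = G c `&` [set y | forall d, d \in s -> (AB d).1 y].
  by rewrite /V' eqxx.
have V's d : d \in s -> V' d = V d `&` (AB d).2.
  by move=> ds; rewrite /V'; case: eqP => // dc; rewrite -dc ds in cs.
exists V'; split=> [d|d e z].
  rewrite inE => /orP [/eqP ->|ds].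
    rewrite V'c; split; last by move=> z [].
      by apply: openI => //; apply: open_all_seq => e /HAB [].
    by exists y; split=> // e /HAB [].
  rewrite V's //; have [oV _ VG] := HV d ds; have [oA oB Ay ne AB0] := HAB d ds.
  by split=> //; [exact: openI|move=> z [/VG]].
have cd f : f \in s -> V' c z -> V' f z -> False.
  move=> fs; rewrite V'c V's // => -[_ /(_ f fs) Az] [_ Bz].
  have [_ _ _ _ /seteqP [+ _]] := HAB f fs.
  by move=> /(_ z); apply.
rewrite !inE => /orP [/eqP ->|ds] /orP [/eqP ->|es] // Vd Ve.
- by have := cd e es Vd Ve.
- by have := cd d ds Ve Vd.
by move: Vd Ve; rewrite !V's // => -[Vd _] [Ve _]; exact: Vdis Vd Ve.
Qed.

Lemma skeletal_functor_of_fold (F : comp_functor) : functor_1mec F ->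
  (forall Z : compactum, zero_dim Z -> skeletal (fmor F (fold2 Z))) ->
  skeletal_functor F.
Proof.
move=> F1 HF X Y f fO fS; have [mF eF cF pF] := F1.
have [T0 [p [zT0 pS pI]]] := irreducible_cover X.
apply/skeletalP => U oU [x Ux].
have [x0 x0x] := epi_fmor eF pS x.
have oU0 : open (fmor F p @^-1` U) by exact: open_preim.
have Ux0 : (fmor F p @^-1` U) x0 by rewrite /preimage /= x0x.
have [J [fJ [W [oW Wx WU]]]] := open_determined_quot mF cF zT0 oU0 Ux0.
set q := quot_map J in Wx WU.
have fQ := finite_quot fJ.
pose h : continuousType T0 Y := f \o p.
have hS y : exists t, h t = y.
  have [z _ zy] := fS y Logic.I; have [t tz] := pS z.
  by exists t; rewrite /h /= tz.
pose S c := q @^-1` [set c].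
have oS c : open (S c) by apply: open_preim; exact: finite_open.
(* The image under [f] of the points whose whole fiber under [p] lies in the cell [S c]. It is
   nonempty by irreducibility of [p] and open since [f] is open. *)
pose G c := f @` (~` (p @` (~` S c))).
have oG c : open (G c).
  by apply: fO; apply: closed_openC; apply: closed_image; exact: open_closedC.
have GS c y : G c y -> exists2 t, q t = c & h t = y.
  move=> [z nz <-]; have [t tz] := pS z; exists t; last by rewrite /h /= tz.
  by apply: contrapT => nSt; apply: nz; exists t.
have nG c : G c !=set0.
  have [|z Hz] := pI _ (oS c).
    by have [t tc] := quot_map_surj c; exists t.
  by exists (f z), z => // -[t nSt /Hz].
(* A cell with an isolated point of [Y] in [G c] is represented by one point [t_ c] over such a
   point; the other cells get pairwise disjoint open sets [V c] inside [G c]. *)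
pose Iso c := exists2 y, G c y & open [set y].
have /choice [t_ Ht] : forall c, exists t, q t = c /\ (Iso c -> open [set h t]).
  move=> c; have [[y Gy oy]|nI] := pselect (Iso c).
    by have [t tc ty] := GS c y Gy; exists t; rewrite ty.
  by have [y /GS [t tc _]] := nG c; exists t.
have [s Qs] := (finite_seqP [set: quot J]).1 fQ.
have inQ c : c \in s by have : [set: quot J] c by []; rewrite Qs.
have [c|V [HV Vdis]] := @disjoint_refinement Y _ [seq c <- s | ~~ `[<Iso c>]] G.
  rewrite mem_filter => /andP [/asboolPn nI _]; split=> // y Gy oy.
  by apply: nI; exists y.
have in1 c : ~ Iso c -> c \in [seq c <- s | ~~ `[<Iso c>]].
  by move=> nI; rewrite mem_filter inQ andbT; exact/asboolPn.
pose B := [set h (t_ c) | c in Iso].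
have oB : open B.
  rewrite (_ : B = \bigcup_(c in Iso) [set h (t_ c)]).
    by apply: bigcup_open => c /(proj2 (Ht c)).
  by apply/seteqP; split=> [_ [c Ic <-]|_ [c Ic ->]]; exists c.
(* The fibers over [B] are discarded, and over [V c] only the cell [c] is kept. As the [V c] are
   disjoint and [V c] lies in [G c], the image is still the whole complement of [B]. *)
pose X' := [set t | ~ B (h t) /\ forall c, ~ Iso c -> V c (h t) -> q t = c].
have cX' : closed X'.
  rewrite (_ : X' = ~` (h @^-1` B `|`
      \bigcup_(c in ~` Iso) (h @^-1` V c `&` ~` S c))).
    apply: open_closedC; apply: openU; first exact: open_preim.
    apply: bigcup_open => c nI; have [oV _ _] := HV c (in1 c nI).
    apply: openI; first exact: open_preim.
    by apply: closed_openC; apply: closed_preim; exact: closed_point.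
  apply/seteqP; split=> [t [nB Vt] [//|[c nI [Vc Sc]]]|t nt].
    by apply: Sc; exact: Vt.
  split=> [Bt|c nI Vc]; first by apply: nt; left.
  by apply: contrapT => Sc; apply: nt; right; exists c.
have hX' : h @` X' = ~` B.
  apply/seteqP; split=> [_ [t [nB _] <-] //|y nB].
  have [[c [nI Vc]]|nV] := pselect (exists c, ~ Iso c /\ V c y).
    have [oV _ VG] := HV c (in1 c nI).
    have [t tc ty] := GS c y (VG _ Vc); exists t => //; split; rewrite ty // => d nId Vd.
    by rewrite tc; apply: Vdis (in1 _ nI) (in1 _ nId) Vc Vd.
  have [t ty] := hS y; exists t => //; split; rewrite ty // => c nI Vc.
  by exfalso; apply: nV; exists c.
have [Z [cZ ZX' hZ Zmin]] := minimal_closed_preimage h cX'.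
(* Adding these points to [Z] restores surjectivity onto [Y]. They are finitely many and isolated in
   the union, where only they lie over the open set [B]. *)
pose D := [set t_ c | c in Iso].
have fD : finite_set D by apply: finite_image; apply: (sub_finite_set _ fQ).
have cT : closed (Z `|` D) by apply: closedU => //; exact: finite_points_closed.
have ZB t : Z t -> ~ B (h t) by move=> /ZX' [].
have DB t : D t -> B (h t) by move=> [c Ic <-]; exists c.
pose T := subc cT.
pose i : continuousType T T0 := subc_val.
have iI : injective i by exact: subc_val_inj.
pose hT : continuousType T Y := h \o i.
have TB t : B (hT t) -> D (i t).
  by have [Zt /(ZB _ Zt)|] := subc_val_in t.
have fD' : finite_set (i @^-1` D) by apply: finite_preimage => // s1 t1 _ _ /iI.
have sk : skeletal (fmor F hT).
  apply: (skeletal_almost_irreducible (D := i @^-1` D)) => //.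
  - exact: zero_dimensional_inj iI zT0.
  - move=> d Dd.
    rewrite (_ : [set d] = hT @^-1` B `&` ~` (i @^-1` D `&` ~` [set d])).
      apply: openI; first exact: open_preim.
      apply: closed_openC; apply: finite_points_closed.
      by apply: sub_finite_set fD'; move=> ? [].
    apply/seteqP; split=> [_ ->|t [/TB Dt nt]]; first by split; [exact: DB|move=> [_]; exact].
    by apply: contrapT => td; apply: nt.
  (* Off [D], irreducibility is minimality of [Z]: removing [O] from [Z] must lose some point of the
     image. *)
  - move=> O oO [o Oo] OD.
    have Zo : Z (i o) by have [//|Do] := subc_val_in o; have := OD _ Oo Do.
    pose C := Z `&` i @` (~` O).
    have cC : closed C by apply: closedI => //; apply: closed_image; exact: open_closedC.
    have [y hy nCy] : exists2 y, (h @` X') y & ~ (h @` C) y.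
      apply: contrapT => nE.
      have : C = Z.
        apply: Zmin => //; first by move=> ? [].
        apply/seteqP; split=> [y [t [Zt _] <-]|y hy].
          by rewrite -hZ; exists t.
        by apply: contrapT => nCy; apply: nE; exists y.
      move=> CZ; rewrite -CZ in Zo; case: Zo => _ [o' nO' /iI o'o].
      by apply: nO'; rewrite o'o.
    exists y => t ty; apply: contrapT => nOt; apply: nCy; exists (i t) => //.
    split; last by exists t.
    have [//|Dt] := subc_val_in t; exfalso.
    by rewrite hX' -ty in hy; apply: hy; exact: DB.
  - by move=> d t Dd td; apply: TB; rewrite td; exact: DB.
  - move=> y; have [[c Ic cy]|nB] := pselect (B y).
      have Tc : (Z `|` D) (t_ c) by right; exists c.
      by exists (subpt cT Tc).
    have [t Zt ty] : (h @` Z) y by rewrite hZ hX'.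
    have Tt : (Z `|` D) t by left.
    by exists (subpt cT Tt).
pose qi : continuousType T (quot J) := q \o i.
(* Every cell still meets [T]: through [t_ c], or through a point of [Z] over [V c], which misses
   [B] as it has no isolated points of [Y]. Since [F] is epimorphic, the preimage of [W] in [F T] is
   then nonempty. *)
have qiS c : exists t, qi t = c.
  have [Ic|nI] := pselect (Iso c).
    have Tc : (Z `|` D) (t_ c) by right; exists c.
    by exists (subpt cT Tc); exact: (proj1 (Ht c)).
  have [oV [y Vy] VG] := HV c (in1 c nI).
  have nB : ~ B y.
    move=> [d Id dy]; apply: nI; exists y; first exact: VG.
    by rewrite -dy; exact: (proj2 (Ht d) Id).
  have [t Zt ty] : (h @` Z) y by rewrite hZ hX'.
  have Tt : (Z `|` D) t by left.
  exists (subpt cT Tt); have [_ Xt] := ZX' _ Zt.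
  by apply: Xt => //; rewrite ty.
have [t0 t0x] := epi_fmor eF qiS (fmor F q x0).
have [||V0 oV0 [neV0 VU]] := (skeletalP _).1 sk (fmor F qi @^-1` W).
- exact: open_preim.
- by exists t0; rewrite /= t0x.
exists V0 => //; split=> //; apply: (subset_trans VU); apply: closureS.
move=> _ [t Wt <-]; exists (fmor F p (fmor F i t)).
  by apply: WU; rewrite /= (fmor_factor (h := qi)).
by rewrite -fmor_comp; exact: fmor_factor.
Qed.

(** * Reflection to metrizable quotients *)

Lemma decreasing_closed_sub_open (X : compactum) (A : nat -> set X) (U : set X) :
  (forall n, closed (A n)) -> (forall m n, (m <= n)%N -> A n `<=` A m) ->
  open U -> (forall x, (forall n, A n x) -> U x) -> exists n, A n `<=` U.
Proof.
move=> cA dA oU AU; apply: contrapT => nA.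
have [||||x Ax] := @directed_closed_nonempty X nat (fun n => A n `&` ~` U).
- exact: (inhabits 0%N).
- by move=> n; apply: closedI => //; exact: open_closedC.
- move=> n; apply: contrapT => n0; apply: nA; exists n => x Anx.
  by apply: contrapT => nUx; apply: n0; exists x.
- move=> m n; exists (maxn m n) => x [Ax nUx]; split; split=> //.
    exact: (dA _ _ (leq_maxl m n)).
  exact: (dA _ _ (leq_maxr m n)).
by have [_] := Ax 0%N; apply; apply: AU => n; have [] := Ax n.
Qed.

Lemma agree_clopen (X : topologicalType) (e : nat -> X -> bool) (n : nat) (x : X) :
  (forall k, continuous (e k)) -> clopen [set y | forall k, (k < n)%N -> e k y = e k x].
Proof.
move=> ce; have cl k : clopen (e k @^-1` [set e k x]) by exact: preimage_bool_clopen.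
elim: n => [|n IH].
  rewrite (_ : [set _ | _] = setT); first exact: clopenT.
  by apply/seteqP; split.
rewrite (_ : [set _ | _] = [set y | forall k, (k < n)%N -> e k y = e k x]
    `&` e n @^-1` [set e n x]); first exact: clopenI.
apply/seteqP; split=> [y Hy|y [Hy yn] k].
  by split=> [k kn|]; [apply: Hy; exact: ltnW|exact: Hy].
by rewrite ltnS leq_eqVlt => /orP [/eqP ->|/Hy].
Qed.

Section CountableSeparation.
Variables (X : compactum) (e : nat -> X -> bool).
Hypotheses (ce : forall k, continuous (e k))
  (eI : forall x y, (forall k, e k x = e k y) -> x = y).

Lemma agree_base (x : X) (U : set X) : open U -> U x ->
  exists n, [set y | forall k, (k < n)%N -> e k y = e k x] `<=` U.
Proof.
move=> oU Ux; apply: decreasing_closed_sub_open => //.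
- by move=> n; have [] := agree_clopen n x ce.
- by move=> m n mn y Hy k km; apply: Hy; exact: leq_trans km mn.
- by move=> y Hy; rewrite (_ : y = x) //; apply: eI => k; exact: (Hy k.+1).
Qed.

Lemma countable_basis : exists2 B : set (set X), basis B & countable B.
Proof.
pose cyl (s : seq bool) := [set y | forall k, (k < size s)%N -> e k y = nth false s k].
have cylE x n : cyl (mkseq (e ^~ x) n) = [set y | forall k, (k < n)%N -> e k y = e k x].
  rewrite /cyl size_mkseq; apply/seteqP; split=> y Hy k kn; have := Hy k kn;
    by rewrite nth_mkseq.
(* A nonempty cylinder is the set of points agreeing with one of its members up to some length, so
   it is clopen. *)
exists [set cyl s | s in setT `&` [set s | cyl s !=set0]].
  split=> [_ [s [_ [x xs]] <-]|x U].
    rewrite (_ : cyl s = cyl (mkseq (e ^~ x) (size s))).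
      by rewrite cylE; have [] := agree_clopen (size s) x ce.
    rewrite cylE; apply/seteqP; split=> y Hy k kn; rewrite Hy // xs //.
  rewrite nbhsE => -[V [oV Vx] VU].
  have [n nV] := agree_base oV Vx.
  exists (cyl (mkseq (e ^~ x) n)); last by rewrite cylE => y /nV /VU.
  split=> /=; last by rewrite cylE.
  by exists (mkseq (e ^~ x) n) => //; split=> //; exists x; rewrite cylE.
apply: (card_le_trans (card_image_le _ _)); exact: countableP.
Qed.

(** Distinct points get distance [1 / (n + 1)], where [n] is the first index with different values
    of [e n]. An index separating [x] from [z] separates [y] from one of them, whence the triangle
    inequality. *)
Lemma metrizable_of_bool_seq (R : realType) : metrizable R X.
Proof.
pose r n : R := (n.+1%:R^-1)%R.
have r_gt0 n : (0 < r n)%R by rewrite invr_gt0 ltr0n.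
have r_lt m n : (r m < r n)%R = (n < m)%N.
  by rewrite ltf_pV2 ?posrE ?ltr0n // ltr_nat ltnS.
have r_le m n : (r m <= r n)%R = (n <= m)%N.
  by rewrite lef_pV2 ?posrE ?ltr0n // ler_nat ltnS.
have /choice [d dP] : forall p : X * X, exists u : R,
    (p.1 = p.2 -> u = 0%R) /\ (p.1 <> p.2 -> exists n, [/\ u = r n,
      e n p.1 <> e n p.2 & forall k, (k < n)%N -> e k p.1 = e k p.2]).
  move=> [x y] /=; have [xy|xy] := pselect (x = y); first by exists 0%R; split.
  have ex : exists n, e n x != e n y.
    apply: contrapT => nE; apply: xy; apply: eI => k.
    by apply: contrapT => /eqP kxy; apply: nE; exists k.
  have [n /eqP nxy nmin] := ex_minnP ex.
  exists (r n); split=> // _; exists n; split=> // k kn.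
  by apply: contrapT => /eqP /nmin; rewrite leqNgt kn.
have d0 x : d (x, x) = 0%R by have [->] := dP (x, x).
have dE x y : x <> y -> exists n, [/\ d (x, y) = r n, e n x <> e n y &
    forall k, (k < n)%N -> e k x = e k y].
  by have [_] := dP (x, y).
have d_ge0 x y : (0 <= d (x, y))%R.
  have [->|/dE [n [-> _ _]]] := pselect (x = y); first by rewrite d0.
  exact: ltW.
have d_ge x y n : e n x <> e n y -> (r n <= d (x, y))%R.
  move=> nxy; have [xy|/dE [m [-> _ mxy]]] := pselect (x = y); first by case: nxy; rewrite xy.
  by rewrite r_le leqNgt; apply/negP => /mxy.
have d_sym x y : (d (x, y) <= d (y, x))%R.
  have [->//|/dE [n [-> nxy _]]] := pselect (x = y).
  by apply: d_ge => /esym.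
exists (fun x y => d (x, y)); split.
- move=> x y; split=> [dxy|->]; last exact: d0.
  apply: contrapT => /dE [n [dn _ _]]; have := r_gt0 n.
  by rewrite -dn dxy ltxx.
- by move=> x y; apply: le_anti; rewrite !d_sym.
- move=> x y z; have [->|/dE [n [-> nxz _]]] := pselect (x = z).
    by rewrite d0 addr_ge0.
  have [nxy|nxy] := pselect (e n x = e n y).
    by rewrite -[r n]add0r lerD // d_ge // -nxy.
  by rewrite -[r n]addr0 lerD // d_ge.
move=> U; split=> [oU x Ux|HU].
  have [n nU] := agree_base oU Ux; exists (r n) => // y /= dxy.
  apply: nU => k kn; apply: contrapT => kxy.
  have := d_ge x y k (nesym kxy); rewrite leNgt; move/negP; apply.
  by apply: (lt_trans dxy); rewrite r_lt.
rewrite openE => x /HU [eps eps0 epsU].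
have [n] := ltr_add_invr eps0; rewrite add0r => neps.
apply: (@filterS _ _ _ [set y | forall k, (k < n.+1)%N -> e k y = e k x]); last first.
  by apply: open_nbhs_nbhs; split=> //; have [] := agree_clopen n.+1 x ce.
move=> y Hy; apply: epsU => /=.
have [->|/dE [m [-> mxy _]]] := pselect (x = y); first by rewrite d0.
apply: (le_lt_trans _ neps); rewrite -/(r n) r_le leqNgt; apply/negP => mn.
by apply: mxy; rewrite Hy // ltnS ltnW.
Qed.

End CountableSeparation.

(** The enumeration may leave [A]: numbers that code no element of [A] are sent to the default [x0],
    which also covers an empty [A]. *)
Lemma countable_enum (T : Type) (A : set T) (x0 : T) : countable A ->
  exists g : nat -> T, forall x, A x -> exists n, g n = x.
Proof.
move=> /countable_injP [f fI].
have /choice [g gP] : forall n, exists x, forall y, A y -> f y = n -> x = y.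
  move=> n; have [[y [Ay yn]]|nE] := pselect (exists y, A y /\ f y = n).
    by exists y => z Az zn; apply: fI; rewrite ?inE ?yn.
  by exists x0 => y Ay yn; exfalso; apply: nE; exists y.
by exists g => x Ax; exists (f x); exact: gP.
Qed.

Lemma quot_metrizable (R : realType) (Z : compactum) (C : set (set Z)) :
  countable C -> metrizable R (quot C).
Proof.
move=> /(countable_enum set0) [g gP].
apply: (@metrizable_of_bool_seq (quot C)
  (fun n (t : quot C) => (subc_val t : cube (set Z)) (g n) : bool)).
  move=> n t; apply: (@continuous_comp _ _ _ (subc_val (cA := @code_range_closed Z C))
    (fun x : cube (set Z) => x (g n) : bool)).
    exact: cts_fun.
  exact: coord_continuous.
move=> x y xy; apply: subc_val_inj; apply/funext => A.
have [/gP [n <-]|nCA] := pselect (C A); first exact: xy.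
have out (v : quot C) : subc_val v A = false.
  have [z _ <-] := subc_val_in v.
  by change (code_fun C z A = false); rewrite /code_fun (asboolF nCA).
by rewrite !out.
Qed.

(** A countable set has countably many finite subsets, so adding all [K J n] keeps it countable.
    After countably many rounds, each finite subset of the union already lies in some stage. *)
Lemma countable_closing_off (T : Type) (S0 : set T) (K : set T -> nat -> set T) :
  finite_set S0 -> (forall J n, finite_set (K J n)) ->
  exists C : set T, [/\ countable C, S0 `<=` C &
    forall J n, finite_set J -> J `<=` C -> K J n `<=` C].
Proof.
move=> fS fK.
pose step (C : set T) := C `|` \bigcup_(J in [set J | J `<=` C /\ finite_set J])
  \bigcup_(n in setT) K J n.
pose Cn n := iter n step S0.
have cCn n : countable (Cn n).
  elim: n => [|n IH]; first exact: finite_set_countable.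
  rewrite /Cn iterS -/(Cn n) /step -bigcup2E.
  apply: bigcup_countable => [|i _]; first exact: countableP.
  rewrite /bigcup2; case: i => [|[|i]] //=.
  apply: bigcup_countable => [|J _]; first exact: countable_finite_subset.
  apply: bigcup_countable => [|k _]; first exact: countableP.
  exact: finite_set_countable.
have mono m n : (m <= n)%N -> Cn m `<=` Cn n.
  move=> /subnK <-; elim: (n - m)%N => [|k IH] //=.
  by apply: (subset_trans IH) => x Hx; left.
exists (\bigcup_(n in setT) Cn n); split.
- by apply: bigcup_countable => // n _; exact: cCn.
- by move=> x Sx; exists 0%N.
move=> J n fJ JC.
have [k Jk] : exists k, J `<=` Cn k.
  have [s Js] := (@finite_seqP {classic T} J).1 fJ.
  suff [k Hk] : exists k, forall x, x \in s -> Cn k x by exists k; rewrite Js.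
  have : forall x, x \in s -> (\bigcup_(n in setT) Cn n) x by move=> x xs; apply: JC; rewrite Js.
  elim: s {Js} => [|x s IH] Hs; first by exists 0%N.
  have [k Hk] := IH (fun y ys => Hs y (mem_behead (s := x :: s) ys)).
  have [l _ Hl] := Hs x (mem_head x s).
  exists (maxn k l) => y; rewrite inE => /orP [/eqP ->|/Hk].
    exact: (mono _ _ (leq_maxr k l)).
  exact: (mono _ _ (leq_maxl k l)).
by move=> x Kx; exists k.+1 => //; right; exists J => //; exists n.
Qed.

(** Weight preservation concerns infinite compacta, so the finite [K] is embedded into the Cantor
    cube. The functor keeps this an embedding, and a countable base is pulled back along it. *)
Lemma finite_countable_base (F : comp_functor) (K : compactum) :
  monomorphic F -> weight_preserving F -> finite_set [set: K] ->
  exists B : nat -> set (F K), (forall n, open (B n)) /\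
    forall x U, open U -> U x -> exists n, B n x /\ B n `<=` U.
Proof.
move=> mF wF fK.
pose e n (x : cube nat) : bool := x n.
have ce n : continuous (e n) by exact: coord_continuous.
have [B bB cB] := @countable_basis (cube nat) e ce (fun x y xy => funext xy).
have inf : infinite_set [set: cube nat].
  move=> fin; apply: infinite_nat.
  pose f (n : nat) : cube nat := fun k => k == n.
  have -> : [set: nat] = f @^-1` setT by [].
  apply: finite_preimage => // m n _ _ /(congr1 (fun g => g m)).
  by rewrite /f eqxx => /esym /eqP.
have [A [oA bA] AB] := wF (cube nat) inf B bB.
have cA : countable A := card_le_trans AB cB.
have [g gP] := countable_enum set0 cA.
have [s Ks] := (finite_seqP [set: K]).1 fK.
have inK k : k \in s by have : [set: K] k by []; rewrite Ks.
pose emb (k : K) : cube nat := fun i => i == index k s.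
have cemb : continuous emb by exact: finite_continuous.
pose embc : continuousType K (cube nat) := mkcts cemb.
have embI : injective embc.
  move=> k l /(congr1 (fun f : cube nat => f (index k s))) /=.
  rewrite /mkcts /emb eqxx => /esym /eqP kl.
  by rewrite -(nth_index k (inK k)) kl nth_index.
have jI := mF _ _ _ embI.
(* Values of the enumeration outside the base are replaced by the empty set, to keep every term
   open. *)
pose A' n := if `[<A (g n)>] then g n else set0.
exists (fun n => fmor F embc @^-1` A' n); split=> [n|x U oU Ux].
  apply: open_preim; rewrite /A'; case: asboolP => [/oA //|_]; exact: open0.
have oV : open (~` (fmor F embc @` (~` U))).
  by apply: closed_openC; apply: closed_image; exact: open_closedC.
have Vx : (~` (fmor F embc @` (~` U))) (fmor F embc x).
  by move=> [y nUy /jI yx]; apply: nUy; rewrite yx.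
have [E [AE Ex] EV] := bA _ _ (open_nbhs_nbhs (conj oV Vx)).
have [n gn] := gP E AE; exists n; rewrite /A' gn (asboolT AE); split=> //.
by move=> y Ey; apply: contrapT => nUy; apply: (EV _ Ey); exists y.
Qed.

(** * Adding finitely many points as a functor, and [fold2] as a natural map *)

Section OplusFunctor.
Variable n : nat.

Lemma oplus_left_continuous (Z : compactum) : continuous (@oplus_left Z n).
Proof. exact: (@existT_continuous _ (oplus_summand Z n) true). Qed.

Definition oplus_leftc (Z : compactum) : continuousType Z (oplus Z n) :=
  mkcts (@oplus_left_continuous Z).

Definition oplus_map (A B : compactum) (f : continuousType A B) :
    continuousType (oplus A n) (oplus B n) :=
  oplus_rec (oplus_leftc B \o f) (@oplus_right B n).

Lemma oplus_map_left (A B : compactum) (f : continuousType A B) a :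
  oplus_map f (oplus_left n a) = oplus_left n (f a).
Proof. by []. Qed.

Lemma oplus_map_right (A B : compactum) (f : continuousType A B) i :
  oplus_map f (@oplus_right A n i) = @oplus_right B n i.
Proof. by []. Qed.

Lemma oplus_map_id (A : compactum) x : oplus_map (idfun : continuousType A A) x = x.
Proof. by have [[a ->]|[i ->]] := oplusP x. Qed.

Lemma oplus_map_comp (A B C : compactum) (f : continuousType A B)
    (g : continuousType B C) x :
  oplus_map (g \o f : continuousType A C) x = oplus_map g (oplus_map f x).
Proof. by have [[a ->]|[i ->]] := oplusP x. Qed.

(** Packaged as a functor so that [image_spectrum] turns the spectrum of finite quotients into a
    spectrum of their sums with [n] points. *)
Definition oplus_functor : comp_functor := CompFunctor oplus_map_id oplus_map_comp.

Lemma oplus_map_surj (A B : compactum) (f : continuousType A B) :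
  (forall b, exists a, f a = b) -> forall y, exists x, oplus_map f x = y.
Proof.
move=> fS y; have [[b ->]|[i ->]] := oplusP y; last by exists (@oplus_right A n i).
by have [a ab] := fS b; exists (oplus_left n a); rewrite oplus_map_left ab.
Qed.

Lemma oplus_left_inj (Z : compactum) : injective (@oplus_left Z n).
Proof. by move=> x y /eqP; rewrite /oplus_left -tag_eqE /tag_eq /= tagged_asE => /eqP. Qed.

Lemma oplus_right_inj (Z : compactum) : injective (@oplus_right Z n).
Proof.
move=> i j /(congr1 (fun x : oplus Z n =>
  if x is existT false k then Some (k : 'I_n) else None)) /=.
by case.
Qed.

Lemma finite_oplus (Z : compactum) :
  finite_set [set: Z] -> finite_set [set: oplus Z n].
Proof.
move=> fZ.
rewrite (_ : [set: oplus Z n] = range (@oplus_left Z n) `|` range (@oplus_right Z n)).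
  rewrite finite_setU; split; first exact: finite_image.
  by apply: finite_image; exact: (@finite_finset 'I_n).
by apply/seteqP; split=> // x _; have [[a ->]|[i ->]] := oplusP x; [left; exists a|right; exists i].
Qed.

(** Stated for any [K] with compatible separating maps to the finite quotients, to serve both for
    [Z] itself and for its quotient [quot D]. *)
Lemma open_determined_oplus (F : comp_functor) (Z K : compactum) (D : set (set Z))
    (r : forall J : qindex D, continuousType K (quot (sval J)))
    (U : set (F (oplus K n))) (x : F (oplus K n)) :
  monomorphic F -> continuous_functor F ->
  (forall (I J : qindex D) (IJ : sval I `<=` sval J) k,
     quot_bond IJ (r J k) = r I k) ->
  (forall k l, (forall J, r J k = r J l) -> k = l) ->
  open U -> U x ->
  exists (J : qindex D) (W : set (F (oplus (quot (sval J)) n))),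
    [/\ open W, W (fmor F (oplus_map (r J)) x) &
        fmor F (oplus_map (r J)) @^-1` W `<=` U].
Proof.
move=> mF cF rb rI oU Ux.
apply: (@open_determined F (image_spectrum oplus_functor (quot_spectrum D)) (oplus K n)
  (fun J => oplus_map (r J)) U x mF cF) => //.
  move=> I J IJ y; change (oplus_map (quot_bond IJ) (oplus_map (r J) y) = oplus_map (r I) y).
  have [[a ->]|[i ->]] := oplusP y; last by rewrite !oplus_map_right.
  by rewrite !oplus_map_left rb.
move=> y z; have [J0 _] := qinhabited D.
have [[a ->]|[i ->]] := oplusP y; have [[b ->]|[j ->]] := oplusP z => yz.
- by congr oplus_left; apply: rI => J; apply: oplus_left_inj; exact: yz.
- by have := yz J0.
- by have := yz J0.
- by have := yz J0; rewrite !oplus_map_right => /oplus_right_inj ->.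
Qed.

End OplusFunctor.

Lemma fold2_natural (A B : compactum) (f : continuousType A B) x :
  fold2 B (oplus_map 2 f x) = oplus_map 1 f (fold2 A x).
Proof. by have [[a ->]|[i ->]] := oplusP x. Qed.

Lemma fmor_fold2_natural (F : comp_functor) (A B : compactum)
    (f : continuousType A B) (z : F (oplus A 2)) :
  fmor F (fold2 B) (fmor F (oplus_map 2 f) z) = fmor F (oplus_map 1 f) (fmor F (fold2 A) z).
Proof. by rewrite -!fmor_comp; apply: eq_fmor => x; exact: fold2_natural. Qed.

Lemma fold2_open (Z : compactum) : open_map (fold2 Z).
Proof.
move=> U oU; apply/sigT_openP => -[]; last exact: discrete_open.
rewrite (_ : _ @^-1` _ = @oplus_left Z 2 @^-1` U).
  by move: U oU; apply/continuousP; exact: oplus_left_continuous.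
apply/seteqP; split=> z /=; last by move=> Uz; exists (oplus_left 2 z).
move=> [x Ux]; have [[a ax]|[i ix]] := oplusP x; rewrite ?ax ?ix in Ux * => //.
by move=> /oplus_left_inj <-.
Qed.

Lemma fold2_surj (Z : compactum) : set_surj setT setT (fold2 Z).
Proof.
move=> y _; have [[z ->]|[i ->]] := oplusP y; first by exists (oplus_left 2 z).
by exists (@oplus_right Z 2 ord0) => //; rewrite (ord1 i).
Qed.

(** Suppose the image of a nonempty open [U] is nowhere dense. Then [U] may be shrunk to depend on a
    finite [J0], and each basic open set coming from a finite quotient contains a nonempty open set
    missing the image, again given by a finite quotient. A countable [C] containing [J0] and closed
    under these choices yields a failure of skeletality over the metrizable [quot C]. *)
Lemma skeletal_fold2_of_metrizable (R : realType) (F : comp_functor) :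
  functor_1mecw F ->
  (forall Z : compactum, zero_dim Z -> metrizable R Z -> skeletal (fmor F (fold2 Z))) ->
  forall Z : compactum, zero_dim Z -> skeletal (fmor F (fold2 Z)).
Proof.
move=> [[mF eF cF pF] wF] HF Z /zero_dim_zero_dimensional zZ.
apply/skeletalP => U oU [x Ux]; apply: contrapT => nV.
have [[J0 [fJ0 J0T]] [W0 [/= oW0 W0x W0U]]] := open_determined_oplus
  (r := fun J : qindex (setT : set (set Z)) => quot_map (sval J)) mF cF
  (fun I J IJ k => quot_bondE IJ k) (quot_maps_separate zZ) oU Ux.
pose pull n J := fmor F (oplus_map n (@quot_map Z J)).
have pullS n J y : exists z, pull n J z = y.
  by apply: (epi_fmor eF); apply: oplus_map_surj => ?; exact: quot_map_surj.
(* One base is fixed for each finite [J], so that the witnesses below can be indexed by [(J, n)];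
   for infinite [J] the value is a dummy. *)
have base J : exists B : nat -> set (F (oplus (@quot Z J) 1)), finite_set J ->
    (forall n, open (B n)) /\
    forall y V, open V -> V y -> exists n, B n y /\ B n `<=` V.
  have [fJ|nfJ] := pselect (finite_set J); last by exists (fun=> set0).
  have [B HB] := finite_countable_base mF wF (finite_oplus 1 (finite_quot fJ)).
  by exists B.
pose B J := sval (cid (base J)).
have BP J : finite_set J -> (forall n, open (B J n)) /\
    forall y V, open V -> V y -> exists n, B J n y /\ B J n `<=` V.
  exact: (svalP (cid (base J))).
have /choice [K KP] : forall p : set (set Z) * nat, exists J', finite_set J' /\
    (finite_set p.1 -> B p.1 p.2 !=set0 ->
     exists W' : set (F (oplus (quot J') 1)), [/\ open W',
       exists y, W' (pull 1%N J' y),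
       forall y, W' (pull 1%N J' y) -> B p.1 p.2 (pull 1%N p.1 y) &
       forall u, U u -> ~ W' (pull 1%N J' (fmor F (fold2 Z) u))]).
  move=> [J n] /=; have [[fJ [b Bb]]|nH] := pselect (finite_set J /\ B J n !=set0); last first.
    by exists set0; split=> // fJ ne; exfalso; apply: nH.
  have [oB _] := BP J fJ.
  have oV : open (pull 1%N J @^-1` B J n) by exact: open_preim.
  have [y [By nCy]] : exists y, B J n (pull 1%N J y) /\
      ~ closure (fmor F (fold2 Z) @` U) y.
    apply: contrapT => nE; apply: nV; exists (pull 1%N J @^-1` B J n) => //.
    split; first by have [y yb] := pullS 1%N J b; exists y; rewrite /= yb.
    by move=> y By; apply: contrapT => nCy; apply: nE; exists y.
  have oV' : open (pull 1%N J @^-1` B J n `&` ~` closure (fmor F (fold2 Z) @` U)).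
    by apply: openI => //; apply: closed_openC; exact: closed_closure.
  have [[J' [fJ' J'T]] [W' [/= oW' W'y W'V]]] := open_determined_oplus
    (r := fun J : qindex (setT : set (set Z)) => quot_map (sval J)) mF cF
    (fun I J IJ k => quot_bondE IJ k) (quot_maps_separate zZ) oV' (conj By nCy).
  exists J'; split=> // _ _; exists W'; split=> //; first by exists y.
    by move=> z /W'V [].
  move=> u Uu /W'V [_]; apply; apply: subset_closure; by exists u.
(* [K (J, n)] witnesses that the image of [U] is not dense in the [n]-th basic
   open set coming from [quot J], so a family closed under [K] reflects this. *)
have [C [cC J0C KC]] := countable_closing_off (K := fun J n => K (J, n)) fJ0
  (fun J n => proj1 (KP (J, n))).
pose ZC := quot C.
have skC : skeletal (fmor F (fold2 ZC)).
  apply: HF; last exact: quot_metrizable.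
  by apply: zero_dimensional_zero_dim; exact: quot_zero_dimensional.
pose res n J (JC : J `<=` C) := fmor F (oplus_map n (quot_bond JC)).
have resE n J (JC : J `<=` C) y : res n J JC (pull n C y) = pull n J y.
  apply: fmor_factor => z; have [[a ->]|[i ->]] := oplusP z => //.
  by rewrite !oplus_map_left quot_bondE.
pose UC := res 2%N J0 J0C @^-1` W0.
have [||VC oVC [[v VCv] VCU]] := (skeletalP _).1 skC UC.
- exact: open_preim.
- by exists (pull 2%N C x); rewrite /UC /= resE.
have [[J [fJ JC]] [W [/= oW Wv WV]]] := open_determined_oplus
  (r := fun J : qindex C => quot_bond (proj2 (svalP J))) mF cF
  (fun I J IJ k => quot_bond_comp IJ (proj2 (svalP J)) (proj2 (svalP I)) k)
  (@quot_bonds_separate Z C) oVC VCv.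
have [_ baseJ] := BP J fJ.
(* A basic set from a finite [J] inside [C] fits into [VC]; its witness [W'] comes from [K (J, n)],
   also inside [C], so it can be read over [quot C]. *)
have [n [Bv BW]] := baseJ _ _ oW Wv.
have [fJ' /= HJ'] := KP (J, n).
have [|W' [oW' [y W'y] W'B W'U]] := HJ' fJ; first by eexists; exact: Bv.
have J'C : K (J, n) `<=` C by exact: KC.
have VCy : VC (pull 1%N C y).
  apply: WV; apply: BW.
  have By (pf : J `<=` C) : B J n (res 1%N J pf (pull 1%N C y)) by rewrite resE; exact: W'B.
  exact: By.
have oW'C : open (res 1%N _ J'C @^-1` W') by exact: open_preim.
have W'Cy : (res 1%N _ J'C @^-1` W') (pull 1%N C y) by rewrite /= resE.
(* The image of [UC] is dense in [VC], so it meets the preimage of [W']. Lifting to [F (oplus Z 2)]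
   by naturality of [fold2] gives a point of [U] that [W'] was chosen to miss. *)
have [_ [[uC UCu <-] W'u]] := VCU _ VCy _ (open_nbhs_nbhs (conj oW'C W'Cy)).
have [u uC_] := pullS 2%N C uC.
apply: (W'U u); first by apply: W0U; rewrite /= -/(pull 2%N J0) -(resE _ _ J0C) uC_.
by move: W'u; rewrite /= -uC_ /pull fmor_fold2_natural -/(pull 1%N C) resE.
Qed.

Theorem theorem1p1 (R : realType) :
  (forall F : comp_functor, functor_1mec F ->
    (skeletal_functor F <->
     forall Z : compactum, zero_dim Z -> skeletal (fmor F (fold2 Z)))) /\
  (forall F : comp_functor, functor_1mecw F ->
    (skeletal_functor F <->
     forall Z : compactum, zero_dim Z -> metrizable R Z ->
       skeletal (fmor F (fold2 Z)))).
Proof.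
(* The forward implications hold because [fold2 Z] is itself an open surjection. *)
have sf (F : comp_functor) (Z : compactum) :
    skeletal_functor F -> skeletal (fmor F (fold2 Z)).
  by apply; [exact: fold2_open|exact: fold2_surj].
split=> F F1; split=> [sF Z *|HF]; try exact: sf.
  exact: skeletal_functor_of_fold.
by apply: skeletal_functor_of_fold (proj1 F1) _; exact: skeletal_fold2_of_metrizable HF.
Qed.
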